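(* Let $W=W(n,p)$ be the number of triangles in the Erdős–Rényi random graph $G(n,p)$ (on $n$ vertices, each edge present independently with probability $p=p(n)$). Suppose $n^\alpha p\to c>0$ as $n\to\infty$ for some $1/2\le\alpha<1$. With $\mu_n=\mathbb{E}W$ and $\sigma_n^2=\mathrm{Var}(W)$, we have $\sigma_n^2\asymp n^3p^3$ and \[ d_{\mathrm{TV}}\bigl(\mathcal{L}(W),\mathrm{TP}(\mu_n,\sigma_n^2)\bigr)=O\bigl(n^{-(1-\alpha)}\bigr),\qquad d_{\mathrm{loc}}\bigl(\mathcal{L}(W),\mathrm{TP}(\mu_n,\sigma_n^2)\bigr)=O\bigl(\sigma_n^{-1}n^{-(1-\alpha)/2}\bigr). \]
   Context: For integer-supported laws with distribution functions $F,G$ (where $F(j)=\mathbb{P}[X\le j]$) and $\Delta F(j)=F(j+1)-F(j)$: $d_{\mathrm{loc}}(F,G)=\sup_{j}|\Delta F(j)-\Delta G(j)|$, $d_{\mathrm{TV}}(F,G)=\frac12\sum_j|\Delta F(j)-\Delta G(j)|$. Translated Poisson: for $\mu\in\mathbb{R}$, $s^2>0$, $Z\sim\mathrm{TP}(\mu,s^2)$ means $Z-\lfloor\mu-s^2\rfloor\sim\mathrm{Po}(s^2+\gamma)$ with $\gamma=\mu-s^2-\lfloor\mu-s^2\rfloor$. *)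

(* Defs.v *)
From HB Require Import structures.
From mathcomp Require Import all_boot all_order all_algebra.
From mathcomp Require Import all_classical all_reals all_analysis.
Set Implicit Arguments. Unset Strict Implicit. Unset Printing Implicit Defensive.
Import Order.TTheory GRing.Theory Num.Theory.
Local Open Scope ring_scope.
Local Open Scope classical_set_scope.

Definition edge (n : nat) : finType := {e : 'I_n * 'I_n | (e.1 < e.2)%N}.

Definition graph (n : nat) : finType := {ffun edge n -> bool}.

Definition adj (n : nat) (g : graph n) (i j : 'I_n) : bool :=
  match @insub _ (fun e : 'I_n * 'I_n => (e.1 < e.2)%N) (edge n) (i, j) with
  | Some e => g e
  | None => false
  end.

Definition triangles (n : nat) (g : graph n) : nat :=
  #|[set t : 'I_n * 'I_n * 'I_n |
      [&& (t.1.1 < t.1.2)%N, (t.1.2 < t.2)%N,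
          adj g t.1.1 t.1.2, adj g t.1.2 t.2 & adj g t.1.1 t.2]]|.

Definition gnp_prob (R : realType) (n : nat) (p : R) (g : graph n) : R :=
  \prod_(e : edge n) (if g e then p else 1 - p).

Definition tri_pmf (R : realType) (n : nat) (p : R) (j : int) : R :=
  match j with
  | Posz k => \sum_(g : graph n | triangles g == k) gnp_prob p g
  | Negz _ => 0
  end.

Definition tri_mean (R : realType) (n : nat) (p : R) : R :=
  \sum_(g : graph n) gnp_prob p g * (triangles g)%:R.

Definition tri_var (R : realType) (n : nat) (p : R) : R :=
  \sum_(g : graph n) gnp_prob p g * ((triangles g)%:R - tri_mean n p) ^+ 2.

Definition poisson_pmf (R : realType) (lam : R) (k : nat) : R :=
  expR (- lam) * lam ^+ k / (k`!)%:R.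

(* Translated Poisson TP(mu, s2): Z - floor(mu - s2) ~ Po(s2 + gamma),
   gamma = mu - s2 - floor(mu - s2). *)
Definition tp_pmf (R : realType) (mu s2 : R) (j : int) : R :=
  let m := Num.floor (mu - s2) in
  let gam := mu - s2 - m%:~R in
  if (m <= j) then poisson_pmf (s2 + gam) `|j - m|%N else 0.

(* d_TV and d_loc between integer-supported laws, given by point masses
   (Delta F(j) = F(j+1) - F(j) = P[X = j+1]). *)
Definition d_tv (R : realType) (f g : int -> R) : \bar R :=
  ((1/2)%:E * \esum_(j in [set: int]) (`|f j - g j|)%:E)%E.

Definition d_loc (R : realType) (f g : int -> R) : \bar R :=
  ereal_sup [set (`|f j - g j|)%:E | j in [set: int]].

(* Main.v *)
(** Let W be the triangle count and F - G the difference of the distribution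
    functions of W and of TP(mu, s2).  A discrete Landau-Kolmogorov inequality
    bounds the l1 norms of the first and second differences of F - G (hence d_TV
    and d_loc) by 4 a / h + 8 h^2 b and 2 a / h^2 + 8 h b for every integer
    h >= 1, where a and b are the l1 norms of F - G and of its third difference.

    - a = O(1): this is the Wasserstein distance.  By local dependence, W obeys
      the Stein identity of TP(mu, s2) up to O(n^3 p^3 |D^2 g|), and the Stein
      solution g of a 1-Lipschitz test function satisfies |D^2 g| <= 4 / lambda.
    - b = O(1 / (n^3 p^3)): switching a single edge that closes exactly one
      triangle moves W by one and is a reversible dynamics, so second differences
      of the law of W are controlled by the fluctuations of the up and down
      rates, which the Efron-Stein inequality bounds.

    Taking h of order n^(1 - alpha), which is the order of n p, gives the rates.
    Only the following is used of triangles: they are 3-sets of edges, two of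
    them share at most one edge, and every edge lies in r = n - 2 of them, with
    r p^2 bounded. *)
Require Import Defs.
From HB Require Import structures.
From mathcomp Require Import all_boot all_order all_algebra.
From mathcomp Require Import ring lra zify.
From mathcomp Require classical_sets.
Set Implicit Arguments. Unset Strict Implicit. Unset Printing Implicit Defensive.
Import Order.TTheory GRing.Theory Num.Theory.
Local Open Scope ring_scope.

(** * Functions of independent Bernoulli variables *)

(** Stein's method with indicator test functions would need smoothness of the law of the count
    conditionally on a neighbourhood of a triangle. Splitting the work avoids this: for 1-Lipschitz
    test functions a sup bound on the second difference of the Stein solution is enough, and the
    third difference of F - G needs no comparison of the laws, since those of F and of G are small
    separately. The interpolation balances a / h against h^2 b, so h is of order b^(-1/3), that is n
    p. This gives 1 / h for d_TV and 1 / h^2 for d_loc; as sigma is of order h^(3/2), the latter is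
    sigma^(-1) h^(-1/2), the stated local rate. The condition alpha >= 1/2 enters through r p^2 <=
    K. It bounds the expected number of triangles meeting a given one, and it keeps the probability
    that exactly one triangle waits for a given edge comparable to r p^2. *)

Section Bernoulli.
Variables (R : realFieldType) (E : finType) (p : R).
Hypothesis p01 : 0 <= p <= 1.
Local Notation cfg := {ffun E -> bool}.
Implicit Types (x y : cfg) (f g : cfg -> R) (A B S : {set E}).

Definition wt x : R := \prod_(e : E) (if x e then p else 1 - p).
Definition Ex f : R := \sum_x wt x * f x.
Definition upd x (e : E) (b : bool) : cfg :=
  [ffun e' => if e' == e then b else x e'].

Lemma updE x e b e' : upd x e b e' = if e' == e then b else x e'.
Proof. by rewrite ffunE. Qed.

Lemma upd_same x e b : upd x e b e = b.
Proof. by rewrite updE eqxx. Qed.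

Lemma upd_id x e : upd x e (x e) = x.
Proof. by apply/ffunP => e'; rewrite updE; case: eqP => [->|]. Qed.

Lemma upd_eq x e b : x e = b -> upd x e b = x.
Proof. by move=> <-; rewrite upd_id. Qed.

Lemma updK x e b c : upd (upd x e b) e c = upd x e c.
Proof. by apply/ffunP => e'; rewrite !updE; case: eqP. Qed.

Lemma updC x e e' b c : e != e' -> upd (upd x e b) e' c = upd (upd x e' c) e b.
Proof.
move=> ne; apply/ffunP => a; rewrite !updE.
by case: (eqVneq a e') => [->|//]; rewrite eq_sym (negbTE ne).
Qed.

Lemma wt_ge0 x : 0 <= wt x.
Proof.
case/andP: p01 => p0 p1; apply: prodr_ge0 => e _.
by case: ifP => _ //; rewrite subr_ge0.
Qed.

Lemma Ex_prod (F : E -> bool -> R) :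
  Ex (fun x => \prod_e F e (x e)) = \prod_e (p * F e true + (1 - p) * F e false).
Proof.
transitivity (\sum_(x : cfg) \prod_e ((if x e then p else 1 - p) * F e (x e))).
  by apply: eq_bigr => x _; rewrite /wt -big_split.
rewrite -(bigA_distr_bigA (fun e b => (if b then p else 1 - p) * F e b)).
by apply: eq_bigr => e _; rewrite big_bool.
Qed.

Lemma Ex1 : Ex (fun=> 1) = 1.
Proof.
have := Ex_prod (fun _ _ => 1); rewrite big1 // => ->.
by rewrite big1 // => e _; rewrite !mulr1 addrC subrK.
Qed.

Lemma eq_Ex f g : f =1 g -> Ex f = Ex g.
Proof. by move=> fg; apply: eq_bigr => x _; rewrite fg. Qed.

Lemma ExD f g : Ex (fun x => f x + g x) = Ex f + Ex g.
Proof. by rewrite /Ex -big_split; apply: eq_bigr => x _; rewrite mulrDr. Qed.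

Lemma ExZ a f : Ex (fun x => a * f x) = a * Ex f.
Proof. by rewrite /Ex mulr_sumr; apply: eq_bigr => x _; rewrite mulrCA. Qed.

Lemma ExB f g : Ex (fun x => f x - g x) = Ex f - Ex g.
Proof.
by rewrite -mulN1r -ExZ -ExD; apply: eq_Ex => x; rewrite mulN1r.
Qed.

Lemma Ex_cst a : Ex (fun=> a) = a.
Proof.
by rewrite (@eq_Ex _ (fun=> a * 1)) ?ExZ ?Ex1 ?mulr1 // => x; rewrite mulr1.
Qed.

Lemma Ex_sum (I : Type) (r : seq I) (P : pred I) (F : I -> cfg -> R) :
  Ex (fun x => \sum_(i <- r | P i) F i x) = \sum_(i <- r | P i) Ex (F i).
Proof.
by rewrite /Ex exchange_big /=; apply: eq_bigr => x _; rewrite mulr_sumr.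
Qed.

Lemma le_Ex f g : (forall x, f x <= g x) -> Ex f <= Ex g.
Proof.
by move=> fg; apply: ler_sum => x _; apply: ler_wpM2l => //; apply: wt_ge0.
Qed.

Lemma Ex_ge0 f : (forall x, 0 <= f x) -> 0 <= Ex f.
Proof. by move=> f0; rewrite -[0](Ex_cst 0); apply: le_Ex. Qed.

Lemma ler_norm_Ex f : `|Ex f| <= Ex (fun x => `|f x|).
Proof.
apply: le_trans (ler_norm_sum _ _ _) _; apply: ler_sum => x _.
by rewrite normrM (ger0_norm (wt_ge0 _)).
Qed.

Lemma Ex_norm_le f g : (forall x, `|f x| <= g x) -> `|Ex f| <= Ex g.
Proof. by move=> fg; apply: le_trans (ler_norm_Ex _) _; apply: le_Ex. Qed.

Lemma wt_upd x e :
  wt x = (if x e then p else 1 - p) * \prod_(e' | e' != e) (if x e' then p else 1 - p).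
Proof. by rewrite /wt (bigD1 e). Qed.

Lemma wt_flip x e : x e = false -> p * wt x = (1 - p) * wt (upd x e true).
Proof.
move=> xe; rewrite (wt_upd x e) (wt_upd (upd x e true) e) upd_same xe.
rewrite mulrCA; do 2!congr (_ * _); apply: eq_bigr => e' /negbTE ne.
by rewrite updE ne.
Qed.

(* Reversibility of the single-edge dynamics with up-rate p and down-rate 1 - p. *)
Lemma detailed_balance e f :
  Ex (fun x => p * (~~ x e)%:R * f (upd x e true)) =
  Ex (fun x => (1 - p) * (x e)%:R * f x).
Proof.
rewrite /Ex (bigID (fun x => x e)) /= [X in X + _]big1 ?add0r; last first.
  by move=> x xe; rewrite xe /= !(mulr0, mul0r).
rewrite [RHS](bigID (fun x => ~~ x e)) /= [X in _ = X + _]big1 ?add0r; last first.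
  by move=> x xe; rewrite (negbTE xe) /= !(mulr0, mul0r).
rewrite [RHS](reindex_onto (fun x => upd x e true) (fun x => upd x e false)) /=; last first.
  by move=> x /negbNE xe; rewrite updK -[in RHS](upd_id x e) xe.
have Q x : (~~ ~~ upd x e true e && (upd (upd x e true) e false == x)) = ~~ x e.
  rewrite upd_same updK /=; apply/eqP/idP => [<-|/negbTE xe]; first by rewrite upd_same.
  by rewrite -[in RHS](upd_id x e) xe.
rewrite (eq_bigl _ _ Q); apply: eq_bigr => x /negbTE xe.
rewrite xe upd_same /= !mulr1 !mulrA [wt x * p]mulrC (wt_flip xe).
by congr (_ * _); rewrite mulrC.
Qed.

(** [avg e] is the conditional expectation given all coordinates but [e]; the square of [dif e],
    times p (1 - p), is the conditional variance. *)
Definition avg e f x := p * f (upd x e true) + (1 - p) * f (upd x e false).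
Definition dif e f x := f (upd x e true) - f (upd x e false).

(** Splitting on [x e] gives four terms. Detailed balance turns the two that evaluate f at the
    flipped configuration into terms that evaluate it at x itself. *)
Lemma Ex_avg e f : Ex (avg e f) = Ex f.
Proof.
have H1 := detailed_balance e (fun x => f (upd x e true)).
have H2 := detailed_balance e (fun x => f (upd x e false)).
have E1 : Ex (avg e f) = Ex (fun x => p * (~~ x e)%:R * f (upd (upd x e true) e true))
   + Ex (fun x => p * (x e)%:R * f (upd x e true))
   + Ex (fun x => (1 - p) * (x e)%:R * f (upd x e false))
   + Ex (fun x => (1 - p) * (~~ x e)%:R * f (upd x e false)).
  rewrite -!ExD; apply: eq_Ex => x; rewrite /avg updK.
  by case: (x e) => /=; ring.
rewrite {}E1 {}H1 -{}H2 -!ExD; apply: eq_Ex => x; rewrite updK.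
have := upd_id x e; case: (x e) => /= ->; ring.
Qed.

Definition depon S f := forall x y, {in S, x =1 y} -> f x = f y.

Lemma depon_upd S f e b x : depon S f -> e \notin S -> f (upd x e b) = f x.
Proof.
move=> fS eS; apply: fS => e' e'S; rewrite updE.
by case: eqP e'S => // ->; rewrite (negbTE eS).
Qed.

Lemma depon_avg S f e : depon S f -> depon (S :\ e) (avg e f).
Proof.
move=> fS x y xy; rewrite /avg; congr (_ * _ + _ * _); apply: fS => a aS;
  rewrite !updE; case: eqP => // /eqP ae; apply: xy; by rewrite !inE ae.
Qed.

Definition avgl l f := foldl (fun h e => avg e h) f l.

Lemma Ex_avgl l f : Ex (avgl l f) = Ex f.
Proof. by elim: l f => //= e l IH f; rewrite IH Ex_avg. Qed.

Lemma eq_avgl l f g : f =1 g -> avgl l f =1 avgl l g.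
Proof.
elim: l f g => //= e l IH f g fg; apply: IH => x.
by rewrite /avg !fg.
Qed.

Lemma depon_avgl S f l : depon S f -> depon (S :\: [set e in l]) (avgl l f).
Proof.
elim: l S f => [|e l IH] S f fS /=.
  by move=> x y xy; apply: fS => e eS; apply: xy; rewrite !inE.
have := IH _ _ (depon_avg (e := e) fS); congr depon.
apply/setP => a; rewrite !inE negb_or.
by case: (a == e) => //=; rewrite andbF.
Qed.

(** Once every coordinate is averaged out nothing is left to depend on, and averaging preserves the
    expectation. *)
Lemma avgl_cst l f : (forall e, e \in l) -> avgl l f =1 (fun=> Ex f).
Proof.
move=> lT.
have c x y : avgl l f x = avgl l f y.
  have fT : depon [set: E] f by move=> a b ab; congr f; apply/ffunP => e; exact: ab.
  apply: (depon_avgl (l := l) fT) => e; rewrite !inE lT.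
  by [].
by move=> x; rewrite -(Ex_avgl l) (@eq_Ex _ (fun=> avgl l f x)) ?Ex_cst.
Qed.

Lemma avgl_mul S f g l : depon S f -> {in l, forall e, e \notin S} ->
  avgl l (fun x => f x * g x) =1 (fun x => f x * avgl l g x).
Proof.
move=> fS; elim: l g => //= e l IH g lS x.
rewrite -IH; last by move=> a al; apply: lS; rewrite inE al orbT.
apply: eq_avgl => {}x; rewrite /avg !(depon_upd _ _ fS) ?lS ?mem_head //.
ring.
Qed.

(** Averaging out the coordinates outside S passes through the factor f and turns g into a
    constant. *)
Lemma Ex_indep S f g : depon S f -> depon (~: S) g ->
  Ex (fun x => f x * g x) = Ex f * Ex g.
Proof.
move=> fS gS; rewrite -(Ex_avgl (enum (~: S))).
rewrite (eq_Ex (avgl_mul g fS _)); last by move=> e; rewrite mem_enum inE.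
rewrite (@eq_Ex _ (fun x => Ex g * f x)) ?ExZ 1?mulrC // => x.
rewrite mulrC; congr (_ * _).
rewrite -(Ex_avgl (enum (~: S)) g) (@eq_Ex _ (fun=> avgl (enum (~: S)) g x)) ?Ex_cst //.
move=> y; apply: (depon_avgl (l := enum (~: S)) gS) => e.
by rewrite !inE mem_enum !inE; case: (e \in S).
Qed.

Definition Var f : R := Ex (fun x => (f x - Ex f) ^+ 2).

Lemma Ex_sqr_avg e f :
  Ex (fun x => f x ^+ 2) =
  Ex (fun x => avg e f x ^+ 2) + p * (1 - p) * Ex (fun x => dif e f x ^+ 2).
Proof.
rewrite -(Ex_avg e) -ExZ -ExD; apply: eq_Ex => x; rewrite /avg /dif; ring.
Qed.

Lemma Ex_sqr_avg_le e f : Ex (fun x => avg e f x ^+ 2) <= Ex (fun x => f x ^+ 2).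
Proof.
case/andP: p01 => p0 p1.
rewrite [leRHS](Ex_sqr_avg e) lerDl mulr_ge0 ?mulr_ge0 ?subr_ge0 //.
by apply: Ex_ge0 => x; rewrite sqr_ge0.
Qed.

Lemma dif_avgC e e' f : e != e' -> dif e' (avg e f) =1 avg e (dif e' f).
Proof.
move=> ne x; rewrite /dif /avg !(updC _ _ _ ne).
ring.
Qed.

(** Coordinates are averaged out one at a time. A later step meets the derivative of an averaged
    function; by [dif_avgC] it is an average of the original derivative, and averaging contracts the
    second moment. *)
Lemma Ex_sqr_avgl l f : uniq l ->
  Ex (fun x => f x ^+ 2) <= Ex (fun x => avgl l f x ^+ 2)
     + \sum_(e <- l) p * (1 - p) * Ex (fun x => dif e f x ^+ 2).
Proof.
case/andP: p01 => p0 p1.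
elim: l f => [|e l IH] f /=; first by rewrite big_nil addr0.
case/andP=> el ul; rewrite big_cons (Ex_sqr_avg e).
have := IH (avg e f) ul => /le_trans H.
rewrite [leRHS]addrCA [leLHS]addrC lerD2l; apply: H.
rewrite lerD2l big_seq [leRHS]big_seq; apply: ler_sum => a al.
apply: ler_wpM2l; first by rewrite mulr_ge0 ?subr_ge0.
have ne : e != a by apply: contraNneq el => ->.
rewrite (@eq_Ex _ (fun x => avg e (dif a f) x ^+ 2)) ?Ex_sqr_avg_le //.
by move=> x; rewrite dif_avgC.
Qed.

Theorem efron_stein f :
  Var f <= \sum_e p * (1 - p) * Ex (fun x => dif e f x ^+ 2).
Proof.
rewrite /Var; have := Ex_sqr_avgl (fun x => f x - Ex f) (enum_uniq E).
rewrite (@eq_Ex (fun x => avgl _ _ _ ^+ 2) (fun=> 0)) ?Ex_cst ?add0r; last first.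
  move=> x; rewrite avgl_cst ?ExB ?Ex_cst ?subrr ?expr0n //.
  by move=> e; rewrite mem_enum.
move/le_trans; apply; rewrite big_enum /=; apply: ler_sum => e _.
rewrite (@eq_Ex _ (fun x => dif e f x ^+ 2)) // => x.
by rewrite /dif opprB addrA subrK.
Qed.

Definition on A x : bool := A \subset [set e | x e].

Lemma onU A B x : on (A :|: B) x = on A x && on B x.
Proof. by rewrite /on subUset. Qed.

Lemma on0 x : on set0 x. Proof. by rewrite /on sub0set. Qed.

Lemma on1 e x : on [set e] x = x e.
Proof. by rewrite /on sub1set inE. Qed.

Lemma Ex_on A : Ex (fun x => (on A x)%:R) = p ^+ #|A|.
Proof.
have E1 x : (on A x)%:R = \prod_e (if e \in A then (x e)%:R else 1) :> R.
  rewrite -big_mkcond /=; case: (boolP (on A x)) => H.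
    by rewrite big1 // => e eA; move/subsetP: H => /(_ e eA); rewrite inE => ->.
  case/subsetPn: H => e eA; rewrite inE => /negbTE xe.
  by rewrite (bigD1 e) //= xe mul0r.
rewrite (eq_Ex E1) (Ex_prod (fun e b => if e \in A then b%:R else 1)).
rewrite -prodr_const [RHS]big_mkcond; apply: eq_bigr => e _.
by case: (e \in A) => /=; rewrite ?mulr1 ?mulr0 ?addr0 // addrC subrK.
Qed.

Lemma depon_on A S : A \subset S -> depon S (fun x => (on A x)%:R).
Proof.
move=> /subsetP AS x y xy; congr (_%:R); rewrite /on; congr nat_of_bool.
apply/subsetP/subsetP => H e eA; have := H e eA; rewrite !inE xy //; exact: AS.
Qed.

Lemma on_upd A x e b : e \notin A -> on A (upd x e b) = on A x.
Proof.
move=> eA; rewrite /on; apply/subsetP/subsetP => H a aA; have := H a aA;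
  rewrite !inE updE; by case: eqP aA => // ->; rewrite (negbTE eA).
Qed.

Lemma on_upd_true A x e : on A (upd x e true) = on (A :\ e) x.
Proof.
apply/subsetP/subsetP => H a aA.
  have := H a; rewrite !inE updE; move: aA; rewrite !inE => /andP[/negbTE -> aA].
  by apply.
rewrite inE updE; case: eqP => // /eqP ne.
by have := H a; rewrite !inE ne aA => /(_ isT).
Qed.

Lemma on_upd_false A x e : e \in A -> on A (upd x e false) = false.
Proof.
move=> eA; apply/negbTE/subsetPn; exists e => //.
by rewrite inE upd_same.
Qed.

End Bernoulli.

(** * Stein's identity for the number of present triples *)

Lemma telescope_le (R : realFieldType) (d : nat -> R) M a z :
  (forall k, `|d k.+1 - d k| <= M) -> `|d (a + z)%N - d a| <= M * z%:R.
Proof.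
move=> dM; elim: z => [|z IH]; first by rewrite addn0 subrr normr0 mulr0.
have -> : d (a + z.+1)%N - d a = (d (a + z).+1 - d (a + z)%N) + (d (a + z)%N - d a).
  by rewrite addnS; ring.
apply: le_trans (ler_normD _ _) _; have := dM (a + z)%N; rewrite -natr1; lra.
Qed.

(** Taylor's formula with the difference taken at the end point a + z: later a is the count far from
    t and a + z the full count, at which Stein's identity wants the difference. *)
Lemma quadratic_remainder_le (R : realFieldType) (g : nat -> R) M a z :
  (forall k, `|(g k.+2 - g k.+1) - (g k.+1 - g k)| <= M) ->
  `|g (a + z)%N - g a - z%:R * (g (a + z).+1 - g (a + z)%N)| <= M * z%:R ^+ 2.
Proof.
move=> gM; set d := fun k => g k.+1 - g k.
have M0 : 0 <= M by apply: le_trans (gM 0%N).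
elim: z => [|z IH]; first by rewrite addn0 subrr sub0r mul0r oppr0 normr0 expr0n mulr0.
have E1 : g (a + z.+1)%N - g a - z.+1%:R * (g (a + z.+1).+1 - g (a + z.+1)%N) =
  (g (a + z)%N - g a - z%:R * (g (a + z).+1 - g (a + z)%N))
  - (z.+1%:R * (d (a + z).+1 - d (a + z)%N)).
  rewrite addnS /d -natr1; ring.
rewrite E1; apply: le_trans (ler_normB _ _) _.
rewrite normrM ger0_norm ?ler0n //.
have := ler_wpM2l (ler0n R z.+1) (gM (a + z)%N); rewrite -/(d _) -/(d _).
have z0 := ler0n R z; rewrite -natr1; nra.
Qed.

Lemma cardU_D (E : finType) (A B : {set E}) : #|A :|: B| = (#|A| + #|B :\: A|)%N.
Proof. by have := cardsUI A B; have := cardsID A B; rewrite setIC; lia. Qed.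

Section Triples.
Variables (R : realFieldType) (E T : finType) (p : R) (tri : T -> {set E}) (r : nat).
Hypothesis p01 : 0 <= p <= 1.
Hypothesis tri3 : forall t, #|tri t| = 3.
Hypothesis trilin : forall t s, t != s -> (#|tri t :&: tri s| <= 1)%N.
Hypothesis trireg : forall e, #|[set t | e \in tri t]| = r.
Local Notation cfg := {ffun E -> bool}.
Local Notation Ex := (@Ex R E p).
Implicit Types (x y : cfg) (A B S : {set E}) (t s u : T) (e f : E).

Let p0 : 0 <= p. Proof. by case/andP: p01. Qed.
Let p1 : p <= 1. Proof. by case/andP: p01. Qed.

Lemma pexp_le m n : (m <= n)%N -> p ^+ n <= p ^+ m.
Proof. by move=> mn; apply: ler_wiXn2l. Qed.

Lemma tri_uniq e f t s :
  e != f -> e \in tri t -> f \in tri t -> e \in tri s -> f \in tri s -> t = s.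
Proof.
move=> ef et ft es fs; apply/eqP/negPn/negP => /trilin.
rewrite leqNgt => /negP; apply.
rewrite (cardD1 e) (cardD1 f) !inE et es ft fs eq_sym ef //.
Qed.

Lemma card_pair_le e f : e != f -> (#|[set t | (e \in tri t) && (f \in tri t)]| <= 1)%N.
Proof.
move=> ef; apply/card_le1_eqP => t s; rewrite !inE => /andP[et ft] /andP[es fs].
exact: (tri_uniq ef).
Qed.

Definition ntri x : nat := \sum_t on (tri t) x.
Definition meets B u : bool := tri u :&: B != set0.
Definition ntri_near B x : nat := \sum_(u | meets B u) on (tri u) x.
Definition ntri_far B x : nat := \sum_(u | ~~ meets B u) on (tri u) x.
(** Bounds the expected number of present triples meeting a set of b edges: each of these edges lies
    in at most b triples that contain another one of them, and in r triples altogether, whose two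
    other edges cost p^2. *)
Definition near_bound (b : nat) : R := b%:R * (b%:R + r%:R * p ^+ 2).

Lemma ntri_split B x : ntri x = (ntri_far B x + ntri_near B x)%N.
Proof. by rewrite /ntri (bigID (meets B)) addnC. Qed.

Lemma near_bound_le a b : (a <= b)%N -> near_bound a <= near_bound b.
Proof.
move=> ab; rewrite /near_bound; have ab' : a%:R <= b%:R :> R by rewrite ler_nat.
apply: ler_pM => //; last by rewrite lerD2r.
by rewrite addr_ge0 // mulr_ge0 // exprn_ge0.
Qed.

Lemma near_bound_ge0 b : 0 <= near_bound b.
Proof. by rewrite /near_bound mulr_ge0 // addr_ge0 // mulr_ge0 // exprn_ge0. Qed.

Lemma sum_meets B : \sum_(u | meets B u) p ^+ #|tri u :\: B| <= near_bound #|B|.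
Proof.
(* Each triple is charged to its edges in B: p^2 pays for a triple with a single edge in B, and the
   unit for each ordered pair of edges in B pays for the others, whose power of p is bounded by
   1. *)
pose F u := \sum_(e in B) (e \in tri u)%:R *
              (p ^+ 2 + \sum_(f in B | f != e) (f \in tri u)%:R).
have F0 e u : 0 <= (e \in tri u)%:R *
              (p ^+ 2 + \sum_(f in B | f != e) (f \in tri u)%:R) :> R.
  by rewrite mulr_ge0 // addr_ge0 ?exprn_ge0 // sumr_ge0.
apply: (@le_trans _ _ (\sum_u F u)).
  rewrite [leRHS](bigID (meets B)) /= -[leLHS]addr0; apply: lerD; last first.
    by apply: sumr_ge0 => u _; apply: sumr_ge0.
  apply: ler_sum => u /set0Pn[e]; rewrite inE => /andP[eu eB].
  rewrite /F (bigD1 e) //= eu mul1r -[leLHS]addr0; apply: lerD; last exact: sumr_ge0.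
  have [|] := leqP #|tri u :&: B| 1 => H.
    have -> : #|tri u :\: B| = 2.
      have : (0 < #|tri u :&: B|)%N by rewrite card_gt0; apply/set0Pn; exists e; rewrite inE eu.
      have := cardsID B (tri u); rewrite tri3; lia.
    by rewrite lerDl sumr_ge0.
  have : (0 < #|(tri u :&: B) :\ e|)%N.
    by have := cardsD1 e (tri u :&: B); rewrite inE eu eB; lia.
  rewrite card_gt0 => /set0Pn[f]; rewrite !inE => /and3P[fe fu fB].
  apply: (@le_trans _ _ 1); first exact: exprn_ile1.
  rewrite (bigD1 f) /= ?fB ?fe // fu addrCA lerDl addr_ge0 ?exprn_ge0 //.
  by apply: sumr_ge0.
rewrite /F exchange_big /= /near_bound -sum1_card natr_sum mulr_suml.
apply: ler_sum => e eB; rewrite mul1r.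
rewrite (eq_bigr (fun t => (e \in tri t)%:R * p ^+ 2 +
    \sum_(f in B | f != e) ((e \in tri t) && (f \in tri t))%:R)); last first.
  move=> t _; rewrite mulrDr mulr_sumr; congr (_ + _); apply: eq_bigr => f _.
  by rewrite -mulnb natrM.
rewrite big_split /= addrC -mulr_suml; apply: lerD; last first.
  rewrite -natr_sum -(trireg e); apply: ler_wpM2r.
    by rewrite exprn_ge0.
  by rewrite -sum1_card ler_nat [leqRHS]big_mkcond; apply: leq_sum => t _; rewrite inE; case: ifP.
rewrite exchange_big /= big_mkcondr /=.
apply: ler_sum => f fB; case: ifP => // fe.
rewrite -natr_sum ler_nat; apply: (@leq_trans #|[set t | (e \in tri t) && (f \in tri t)]|).
  rewrite -sum1_card [leqRHS]big_mkcond /=; apply: leq_sum => t _.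
  by rewrite inE; case: ifP.
by apply: card_pair_le; rewrite eq_sym.
Qed.

(** Requiring A to be present only contributes the factor p^#|A|: for the near triples, only the
    edges outside B are charged. *)
Lemma Ex_on_near A B : A \subset B ->
  Ex (fun x => (on A x)%:R * (ntri_near B x)%:R) <= p ^+ #|A| * near_bound #|B|.
Proof.
move=> AB; apply: (@le_trans _ _ (\sum_(u | meets B u) p ^+ #|A :|: tri u|)).
  rewrite (@eq_Ex _ _ _ _ (fun x => \sum_(u | meets B u) (on (A :|: tri u) x)%:R)).
    by rewrite Ex_sum; apply: ler_sum => u _; rewrite Ex_on.
  move=> x; rewrite natr_sum mulr_sumr; apply: eq_bigr => u _.
  by rewrite onU -mulnb natrM.
apply: le_trans (ler_wpM2l (exprn_ge0 _ p0) (sum_meets B)).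
rewrite mulr_sumr; apply: ler_sum => u _; rewrite cardU_D exprD.
apply: ler_wpM2l; rewrite ?exprn_ge0 //; apply: pexp_le.
by apply: subset_leq_card; apply: setDS.
Qed.

Lemma Ex_near B : Ex (fun x => (ntri_near B x)%:R) <= near_bound #|B|.
Proof.
have := Ex_on_near (sub0set B); rewrite cards0 expr0 mul1r; apply: le_trans.
by apply: le_Ex => // x; rewrite on0 mul1r.
Qed.

Definition ind t x : R := (on (tri t) x)%:R.

Lemma ntriE x : (ntri x)%:R = \sum_t ind t x.
Proof. by rewrite /ntri natr_sum. Qed.

Lemma ntri_nearE B x : (ntri_near B x)%:R = \sum_(s | meets B s) ind s x.
Proof. by rewrite /ntri_near natr_sum. Qed.

Lemma Ex_ind t : Ex (ind t) = p ^+ 3.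
Proof. by rewrite Ex_on tri3. Qed.

Lemma ind_ge0 t x : 0 <= ind t x. Proof. exact: ler0n. Qed.

Lemma Ex_ntri : Ex (fun x => (ntri x)%:R) = #|T|%:R * p ^+ 3.
Proof.
rewrite (eq_Ex _ ntriE) Ex_sum (eq_bigr (fun=> p ^+ 3)) => [|t _]; last exact: Ex_ind.
by rewrite sumr_const mulr_natl.
Qed.

Lemma ntri_far_depon B (F : nat -> R) : depon (~: B) (fun x => F (ntri_far B x)).
Proof.
move=> x y xy; congr F; apply: eq_bigr => u uB; congr nat_of_bool.
apply/subsetP/subsetP => H e eu; have := H e eu; rewrite !inE xy // inE;
  apply: contra uB => eB; apply/set0Pn; exists e; by rewrite inE eu.
Qed.

Lemma ind_depon t S : tri t \subset S -> depon S (ind t).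
Proof. exact: depon_on. Qed.

Lemma ntri_near_mono A B x : A \subset B -> (ntri_near A x <= ntri_near B x)%N.
Proof.
move=> AB; rewrite /ntri_near big_mkcond [leqRHS]big_mkcond; apply: leq_sum => u _.
case: ifP => // /set0Pn[e]; rewrite inE => /andP[eu eA].
rewrite ifT //; apply/set0Pn; exists e; by rewrite inE eu (subsetP AB).
Qed.

(** Centring one factor suffices for a covariance, and this one-sided form is what the expansion of
    Stein's identity produces. *)
Definition tri_cov t s : R := Ex (fun x => (ind t x - p ^+ 3) * ind s x).

Lemma tri_covE t s : tri_cov t s = p ^+ #|tri t :|: tri s| - p ^+ 6.
Proof.
rewrite /tri_cov (@eq_Ex _ _ _ _ (fun x => (on (tri t :|: tri s) x)%:R - p ^+ 3 * ind s x)).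
  by rewrite ExB ExZ Ex_on Ex_ind -exprD.
by move=> x; rewrite mulrBl onU -mulnb natrM.
Qed.

(* The part of the triangle count disjoint from t does not contribute. *)
Lemma Ex_centered t (F : nat -> R) :
  Ex (fun x => (ind t x - p ^+ 3) * F (ntri x)) =
  Ex (fun x => (ind t x - p ^+ 3) * (F (ntri x) - F (ntri_far (tri t) x))).
Proof.
rewrite [RHS](@eq_Ex _ _ _ _ (fun x => (ind t x - p ^+ 3) * F (ntri x) -
   (ind t x - p ^+ 3) * F (ntri_far (tri t) x))); last by move=> x; rewrite mulrBr.
rewrite ExB (@Ex_indep _ _ _ (tri t) (fun x => ind t x - p ^+ 3)
  (fun x => F (ntri_far (tri t) x))).
- by rewrite [X in _ - X * _]ExB Ex_ind Ex_cst subrr mul0r subr0.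
- by move=> x y xy; rewrite (@ind_depon t (tri t) _ x y).
- exact: ntri_far_depon.
Qed.

Lemma Ex_centered_sum (F : nat -> R) :
  Ex (fun x => ((ntri x)%:R - Ex (fun x => (ntri x)%:R)) * F (ntri x)) =
  \sum_t Ex (fun x => (ind t x - p ^+ 3) * F (ntri x)).
Proof.
rewrite -Ex_sum; apply: eq_Ex => x; rewrite -mulr_suml Ex_ntri ntriE; congr (_ * _).
by rewrite big_split /= sumrN sumr_const mulr_natl.
Qed.

(** [Ex_centered] with F the identity leaves the near count of each t, so only overlapping pairs
    contribute. *)
Lemma Var_ntri : Var p (fun x => (ntri x)%:R) = \sum_t \sum_(s | meets (tri t) s) tri_cov t s.
Proof.
set m := Ex (fun x => (ntri x)%:R).
have -> : Var p (fun x => (ntri x)%:R) = Ex (fun x => ((ntri x)%:R - m) * (ntri x)%:R).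
  rewrite /Var -/m (@eq_Ex _ _ _ _ (fun x => ((ntri x)%:R - m) * (ntri x)%:R - m * ((ntri x)%:R - m))).
    by rewrite ExB ExZ ExB Ex_cst // -/m subrr mulr0 subr0.
  by move=> x; ring.
rewrite (Ex_centered_sum (fun k => k%:R)); apply: eq_bigr => t _.
rewrite (Ex_centered t (fun k => k%:R)) /tri_cov -Ex_sum; apply: eq_Ex => x.
by rewrite (ntri_split (tri t)) natrD addrAC subrr add0r ntri_nearE mulr_sumr.
Qed.

Lemma cardU_le6 t s : (#|tri t :|: tri s| <= 6)%N.
Proof. by rewrite (leq_trans (leq_card_setU _ _)) // !tri3. Qed.

Lemma sum_pair t : \sum_(s | meets (tri t) s) (p ^+ #|tri t :|: tri s| + p ^+ 6)
  <= 2 * (p ^+ 3 * near_bound 3).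
Proof.
apply: (@le_trans _ _ (\sum_(s | meets (tri t) s) 2 * (p ^+ 3 * p ^+ #|tri s :\: tri t|))).
  apply: ler_sum => s _; rewrite cardU_D tri3 exprD.
  have : p ^+ 6 <= p ^+ 3 * p ^+ #|tri s :\: tri t|.
    rewrite -exprD; apply: pexp_le; have := cardsID (tri t) (tri s).
    by rewrite tri3; lia.
  lra.
rewrite -mulr_sumr -mulr_sumr; do 2![apply: ler_wpM2l; rewrite ?exprn_ge0 //].
by have := sum_meets (tri t); rewrite tri3.
Qed.

Lemma Ex_pair_near t s : Ex (fun x => (ind t x + p ^+ 3) * ind s x * (ntri_near (tri t :|: tri s) x)%:R)
  <= near_bound 6 * (p ^+ #|tri t :|: tri s| + p ^+ 6).
Proof.
set B := tri t :|: tri s.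
rewrite (@eq_Ex _ _ _ _ (fun x => (on B x)%:R * (ntri_near B x)%:R + p ^+ 3 * (ind s x * (ntri_near B x)%:R))).
  rewrite ExD ExZ mulrDr; have k6 := near_bound_le (cardU_le6 t s).
  apply: lerD.
    apply: le_trans (Ex_on_near (subxx _)) _; rewrite mulrC.
    by apply: ler_wpM2r => //; rewrite exprn_ge0.
  rewrite -[6%N]/(3 + 3)%N exprD mulrCA; apply: ler_wpM2l; first by rewrite exprn_ge0.
  apply: le_trans (Ex_on_near (subsetUr _ _)) _; rewrite tri3 mulrC.
  by apply: ler_wpM2r => //; rewrite exprn_ge0.
by move=> x; rewrite /ind onU -mulnb natrM; ring.
Qed.

Lemma norm_center t x : `|ind t x - p ^+ 3| <= ind t x + p ^+ 3.
Proof.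
apply: le_trans (ler_normB _ _) _; by rewrite !ger0_norm ?exprn_ge0.
Qed.

Section SteinIdentity.
Variables (g : nat -> R) (M : R).
Hypothesis gM : forall k, `|(g k.+2 - g k.+1) - (g k.+1 - g k)| <= M.
Let d k := g k.+1 - g k.
Let M0 : 0 <= M. Proof. exact: le_trans (gM 0%N). Qed.

(** The count far from both t and s is independent of the two indicators. Substituting it for the
    full count in either expectation costs M times the near count, whence the factor 2. *)
Lemma pair_error t s :
  `|Ex (fun x => (ind t x - p ^+ 3) * ind s x * d (ntri x)) - tri_cov t s * Ex (fun x => d (ntri x))|
  <= 2 * M * near_bound 6 * (p ^+ #|tri t :|: tri s| + p ^+ 6).
Proof.
set B := tri t :|: tri s.
have dW x : `|d (ntri x) - d (ntri_far B x)| <= M * (ntri_near B x)%:R.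
  by rewrite (ntri_split B); apply: telescope_le.
have -> : Ex (fun x => (ind t x - p ^+ 3) * ind s x * d (ntri x)) - tri_cov t s * Ex (fun x => d (ntri x))
  = Ex (fun x => (ind t x - p ^+ 3) * ind s x * (d (ntri x) - d (ntri_far B x)))
  - tri_cov t s * Ex (fun x => d (ntri x) - d (ntri_far B x)).
  rewrite (ExB _ (fun x => d (ntri x))) [X in _ = X - _](@eq_Ex _ _ _ _
    (fun x => (ind t x - p ^+ 3) * ind s x * d (ntri x) - (ind t x - p ^+ 3) * ind s x * d (ntri_far B x))).
    rewrite [X in _ = X - _]ExB (@Ex_indep _ _ _ B (fun x => (ind t x - p ^+ 3) * ind s x)
      (fun x => d (ntri_far B x))) -/(tri_cov t s).
    - ring.
    - move=> x y xy; rewrite (@ind_depon t B _ x y) ?subsetUl //.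
      by rewrite (@ind_depon s B _ x y) ?subsetUr.
    - exact: ntri_far_depon.
  by move=> x; rewrite mulrBr.
apply: le_trans (ler_normB _ _) _.
set c := p ^+ #|B| + p ^+ 6.
have c0 : 0 <= c by rewrite addr_ge0 ?exprn_ge0.
have h1 : `|Ex (fun x => (ind t x - p ^+ 3) * ind s x * (d (ntri x) - d (ntri_far B x)))|
   <= M * (near_bound 6 * c).
  apply: le_trans (ler_wpM2l M0 (Ex_pair_near t s)); rewrite -ExZ.
  apply: Ex_norm_le => // x; rewrite !normrM (ger0_norm (ind_ge0 s x)).
  rewrite mulrCA; apply: ler_pM => //; first by rewrite mulr_ge0 // ind_ge0.
  by apply: ler_wpM2r; [exact: ind_ge0|exact: norm_center].
have h2 : `|tri_cov t s| <= c.
  rewrite tri_covE; apply: le_trans (ler_normB _ _) _.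
  by rewrite !ger0_norm ?exprn_ge0.
have h3 : `|Ex (fun x => d (ntri x) - d (ntri_far B x))| <= M * near_bound 6.
  apply: le_trans (Ex_norm_le p01 dW) _; rewrite ExZ; apply: ler_wpM2l => //.
  by apply: le_trans (Ex_near _) (near_bound_le (cardU_le6 t s)).
rewrite normrM; have := ler_pM (normr_ge0 _) (normr_ge0 _) h2 h3; lra.
Qed.

Lemma quad_error t :
  `|Ex (fun x => (ind t x - p ^+ 3) * g (ntri x)) -
    \sum_(s | meets (tri t) s) Ex (fun x => (ind t x - p ^+ 3) * ind s x * d (ntri x))|
  <= M * near_bound 6 * \sum_(s | meets (tri t) s) (p ^+ #|tri t :|: tri s| + p ^+ 6).
Proof.
set B := tri t.
have -> : Ex (fun x => (ind t x - p ^+ 3) * g (ntri x)) -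
    \sum_(s | meets B s) Ex (fun x => (ind t x - p ^+ 3) * ind s x * d (ntri x)) =
  Ex (fun x => (ind t x - p ^+ 3) * (g (ntri x) - g (ntri_far B x) - (ntri_near B x)%:R * d (ntri x))).
  rewrite Ex_centered -/B -Ex_sum -ExB; apply: eq_Ex => x.
  rewrite ntri_nearE [RHS]mulrBr; congr (_ - _); rewrite mulr_suml mulr_sumr.
  by apply: eq_bigr => s _; rewrite mulrA.
rewrite mulr_sumr; apply: (@le_trans _ _ (\sum_(s | meets B s)
    M * Ex (fun x => (ind t x + p ^+ 3) * ind s x * (ntri_near (B :|: tri s) x)%:R))); last first.
  by apply: ler_sum => s _; rewrite -mulrA; apply: ler_wpM2l => //; exact: Ex_pair_near.
rewrite -mulr_sumr -Ex_sum -ExZ; apply: Ex_norm_le => // x.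
have h : `|g (ntri x) - g (ntri_far B x) - (ntri_near B x)%:R * d (ntri x)| <= M * (ntri_near B x)%:R ^+ 2.
  by rewrite /d (ntri_split B); apply: quadratic_remainder_le.
rewrite normrM; apply: le_trans (ler_pM (normr_ge0 _) (normr_ge0 _) (norm_center t x) h) _.
rewrite mulrCA; apply: ler_wpM2l => //.
(* One factor of the squared near count is opened as a sum over s; the other is enlarged to the
   triples near t or s, so that [Ex_pair_near] applies. *)
rewrite expr2 [X in _ * (X * _)]ntri_nearE mulr_suml mulr_sumr; apply: ler_sum => s _.
rewrite mulrA; apply: ler_wpM2l.
  by rewrite mulr_ge0 ?addr_ge0 ?exprn_ge0 ?ind_ge0.
by rewrite ler_nat; apply: ntri_near_mono; apply: subsetUl.
Qed.

Theorem stein_ntri :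
  `|Ex (fun x => ((ntri x)%:R - Ex (fun x => (ntri x)%:R)) * g (ntri x))
    - Var p (fun x => (ntri x)%:R) * Ex (fun x => d (ntri x))|
  <= 6 * near_bound 6 ^+ 2 * (#|T|%:R * p ^+ 3) * M.
Proof.
rewrite Ex_centered_sum Var_ntri mulr_suml -sumrB.
apply: le_trans (ler_norm_sum _ _ _) _.
(* Here 3 is one unit from [quad_error] and two from [pair_error]; the 2 is that of [sum_pair]. *)
have -> : 6 * near_bound 6 ^+ 2 * (#|T|%:R * p ^+ 3) * M =
  \sum_(t : T) 3 * M * near_bound 6 * (2 * (p ^+ 3 * near_bound 6)).
  by rewrite sumr_const -[X in _ = X]mulr_natl; ring.
apply: ler_sum => t _.
have q := quad_error t; have sp := sum_pair t.
set a := Ex _ in q *; set b := \sum_(s | _) _ in q; set c := \sum_(s | _) _ in q sp.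
have h : `|b - (\sum_(s | meets (tri t) s) tri_cov t s) * Ex (fun x => d (ntri x))|
   <= 2 * M * near_bound 6 * c.
  rewrite mulr_suml -sumrB; apply: le_trans (ler_norm_sum _ _ _) _.
  by rewrite mulr_sumr; apply: ler_sum => s _; exact: pair_error.
have : `|a - (\sum_(s | meets (tri t) s) tri_cov t s) * Ex (fun x => d (ntri x))| <= 3 * M * near_bound 6 * c.
  by rewrite -(subrKA b); apply: le_trans (ler_normD _ _) _; lra.
move/le_trans; apply.
apply: ler_wpM2l; first by rewrite (mulr_ge0 _ (near_bound_ge0 _)) ?(mulr_ge0 _ M0).
apply: le_trans sp _; do 2![apply: ler_wpM2l; rewrite ?exprn_ge0 //].
exact: near_bound_le.
Qed.

End SteinIdentity.

Lemma Var_ntri_le : Var p (fun x => (ntri x)%:R) <= 2 * near_bound 3 * (#|T|%:R * p ^+ 3).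
Proof.
rewrite Var_ntri (_ : 2 * near_bound 3 * _ = \sum_(t : T) 2 * (p ^+ 3 * near_bound 3)).
  apply: ler_sum => t _; apply: le_trans (sum_pair t); apply: ler_sum => s _.
  by rewrite tri_covE lerD2l ge0_cp // ?oppr_le0 exprn_ge0.
by rewrite sumr_const -[X in _ = X]mulr_natl; ring.
Qed.

(** All covariances are nonnegative, so it suffices to keep t itself and one further triple through
    an edge of t. They give p^3 - p^6 and p^5 - p^6, and p^5 makes up for both p^6 when p <= 1/2. *)
Lemma Var_ntri_ge : (1 < r)%N -> p <= 1 / 2 ->
  #|T|%:R * p ^+ 3 <= Var p (fun x => (ntri x)%:R).
Proof.
move=> r2 p2; rewrite Var_ntri.
have -> : #|T|%:R * p ^+ 3 = \sum_(t : T) p ^+ 3.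
  by rewrite sumr_const -[X in _ = X]mulr_natl.
apply: ler_sum => t _.
have [e et] : exists e, e \in tri t.
  by apply/set0Pn; rewrite -card_gt0 tri3.
have : (0 < #|[set s | e \in tri s] :\ t|)%N.
  by have := cardsD1 t [set s | e \in tri s]; rewrite trireg !inE et; lia.
rewrite card_gt0 => /set0Pn[s]; rewrite !inE => /andP[st es].
have me u : e \in tri u -> meets (tri t) u.
  by move=> eu; apply/set0Pn; exists e; rewrite inE eu.
rewrite (bigD1 t) ?me //= (bigD1 s) ?me ?st //= addrA -[leLHS]addr0.
apply: lerD; last first.
  apply: sumr_ge0 => u _; rewrite tri_covE subr_ge0; apply: pexp_le.
  exact: cardU_le6.
rewrite !tri_covE setUid tri3.
have -> : #|tri t :|: tri s| = 5.
  have := trilin st; have : (0 < #|tri s :&: tri t|)%N.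
    by rewrite card_gt0; exact: (me s es).
  have := cardsUI (tri s) (tri t); rewrite setUC !tri3; lia.
have : p ^+ 6 <= p ^+ 5 * (1 / 2) by rewrite exprSr ler_wpM2l ?exprn_ge0.
lra.
Qed.

End Triples.

(** * Smoothness of the law of the number of present triples *)

Lemma pair_rem (E : finType) (a b : E) : a != b -> [set a; b] :\ a = [set b].
Proof.
move=> ab; apply/setP => f; rewrite !inE.
by case: (eqVneq f a) => [->|] //=; rewrite (negbTE ab).
Qed.

Lemma setDDC (E : finType) (A : {set E}) e f : A :\ e :\ f = A :\ f :\ e.
Proof. by rewrite !setDDl setUC. Qed.

Lemma sqr_le (R : realFieldType) (a b : R) : `|a| <= b -> a ^+ 2 <= b ^+ 2.
Proof.
move=> ab; rewrite -[a ^+ 2]real_normK ?num_real //.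
by rewrite lerXn2r ?nnegrE //; apply: le_trans ab.
Qed.

Section Smoothing.
Variables (R : realFieldType) (E T : finType) (p : R) (tri : T -> {set E}) (r : nat).
Hypothesis p01 : 0 <= p <= 1.
Hypothesis tri3 : forall t, #|tri t| = 3.
Hypothesis trilin : forall t s, t != s -> (#|tri t :&: tri s| <= 1)%N.
Hypothesis trireg : forall e, #|[set t | e \in tri t]| = r.
Local Notation cfg := {ffun E -> bool}.
Local Notation Ex := (@Ex R E p).
Local Notation W := (ntri tri).
Implicit Types (x y : cfg) (A B S : {set E}) (t s u : T) (e f : E).

Let p0 : 0 <= p. Proof. by case/andP: p01. Qed.
Let p1 : p <= 1. Proof. by case/andP: p01. Qed.
Let q0 : 0 <= 1 - p. Proof. by rewrite subr_ge0. Qed.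

(** The triples that wait only for [e]: switching [e] changes the count by exactly this number. *)
Definition wedges e x : nat := \sum_(t | e \in tri t) on (tri t :\ e) x.
Definition single e x : bool := wedges e x == 1%N.
Definition up e x : R := p * (~~ x e)%:R * (single e x)%:R.
Definition down e x : R := (1 - p) * (x e)%:R * (single e x)%:R.
Definition up_rate x : R := \sum_e up e x.
Definition down_rate x : R := \sum_e down e x.

Lemma wedges_upd e x b : wedges e (upd x e b) = wedges e x.
Proof. by apply: eq_bigr => t _; rewrite on_upd // !inE eqxx. Qed.

Lemma single_upd e x b : single e (upd x e b) = single e x.
Proof. by rewrite /single wedges_upd. Qed.

Lemma ntri_upd e x : W (upd x e true) = (W (upd x e false) + wedges e x)%N.
Proof.
rewrite /ntri (bigID (fun t => e \in tri t)) [in RHS](bigID (fun t => e \in tri t)) /=.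
rewrite [X in _ = (X + _ + _)%N]big1 => [|t et]; last by rewrite on_upd_false.
rewrite add0n addnC; congr (_ + _)%N; apply: eq_bigr => t et.
  by rewrite !on_upd.
by rewrite on_upd_true.
Qed.

(** [single e] does not look at the state of [e], so detailed balance survives the restriction to
    switches that move the count by one. *)
Lemma up_balance (G : E -> cfg -> R) :
  Ex (fun x => \sum_e up e x * G e (upd x e true)) =
  Ex (fun x => \sum_e down e x * G e x).
Proof.
rewrite !Ex_sum; apply: eq_bigr => e _.
have := detailed_balance p e (fun x => (single e x)%:R * G e x).
rewrite [X in X = _ -> _](@eq_Ex _ _ _ _ (fun x => up e x * G e (upd x e true))).
  move=> ->; apply: eq_Ex => x; by rewrite /down mulrA.
by move=> x; rewrite single_upd /up !mulrA.
Qed.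

Lemma up_ntri e x (F : nat -> R) : up e x * F (W (upd x e true)) = up e x * F (W x).+1.
Proof.
rewrite /up; case xe: (x e); first by rewrite mulr0 !mul0r.
case: (boolP (single e x)) => [/eqP s1|_]; last by rewrite mulr0 !mul0r.
by rewrite ntri_upd s1 addn1 (upd_eq xe).
Qed.

Lemma up_rate_balance (F : nat -> R) :
  Ex (fun x => up_rate x * F (W x).+1) = Ex (fun x => down_rate x * F (W x)).
Proof.
transitivity (Ex (fun x => \sum_e up e x * F (W (upd x e true)))).
  by apply: eq_Ex => x; rewrite mulr_suml; apply: eq_bigr => e _; rewrite up_ntri.
rewrite (up_balance (fun e x => F (W x))); apply: eq_Ex => x.
by rewrite mulr_suml.
Qed.

(** Rate of two successive up moves; it would equal [up_rate ^+ 2] if the up rate were constant. *)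
Definition up_rate2 x : R := \sum_e up e x * up_rate (upd x e true).
Definition down_rate2 x : R := \sum_e down e x * down_rate (upd x e false).

(** Reversing the first of the two up moves makes the middle state the starting point, with one move
    up and one move down from it. *)
Lemma up_rate2_balance (F : nat -> R) :
  Ex (fun x => up_rate2 x * F (W x).+2) = Ex (fun x => up_rate x * down_rate x * F (W x).+1).
Proof.
transitivity (Ex (fun x => \sum_e up e x *
    (fun y => up_rate y * F (W y).+1) (upd x e true))).
  apply: eq_Ex => x; rewrite mulr_suml; apply: eq_bigr => e _.
  rewrite mulrAC -(up_ntri e x (fun k => F k.+1)); ring.
rewrite (up_balance (fun e y => up_rate y * F (W y).+1)); apply: eq_Ex => x.
by rewrite -mulr_suml; rewrite -/(down_rate x); ring.
Qed.

Lemma down_rate2_balance (F : nat -> R) :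
  Ex (fun x => down_rate2 x * F (W x)) = Ex (fun x => up_rate x * down_rate x * F (W x).+1).
Proof.
transitivity (Ex (fun x => \sum_e down e x * (down_rate (upd x e false) * F (W x)))).
  by apply: eq_Ex => x; rewrite mulr_suml; apply: eq_bigr => e _; rewrite mulrA.
rewrite -(up_balance (fun e y => down_rate (upd y e false) * F (W y))); apply: eq_Ex => x.
rewrite /up_rate !mulr_suml; apply: eq_bigr => e _.
rewrite updK mulrCA (up_ntri e x F) /up.
case xe: (x e); first by rewrite mulr0 !mul0r mulr0.
by rewrite (upd_eq xe); ring.
Qed.

Let u := Ex up_rate.

Lemma Ex_down_rate : Ex down_rate = u.
Proof.
have := up_rate_balance (fun=> 1); rewrite (@eq_Ex _ _ _ _ up_rate) ?(@eq_Ex _ _ _ (fun x => down_rate x * 1) down_rate) //.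
- by move=> x; rewrite mulr1.
- by move=> x; rewrite mulr1.
Qed.

(* Two steps of the reversible dynamics: the cross terms cancel because both
   up_rate2 at W + 2 and down_rate2 at W balance against up_rate * down_rate at W + 1. *)
Lemma second_difference (F : nat -> R) :
  u ^+ 2 * Ex (fun x => F (W x).+2 - 2 * F (W x).+1 + F (W x)) =
  Ex (fun x => (up_rate x - u) ^+ 2 * F (W x).+2) - 2 * Ex (fun x => (up_rate x - u) * (down_rate x - u) * F (W x).+1)
  + Ex (fun x => (down_rate x - u) ^+ 2 * F (W x))
  + Ex (fun x => (up_rate2 x - up_rate x ^+ 2) * F (W x).+2) + Ex (fun x => (down_rate2 x - down_rate x ^+ 2) * F (W x)).
Proof.
have b1 := up_rate_balance F; have b2 := up_rate_balance (fun k => F k.+1).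
have b3 := up_rate2_balance F; have b4 := down_rate2_balance F.
have -> : Ex (fun x => F (W x).+2 - 2 * F (W x).+1 + F (W x)) =
  Ex (fun x => F (W x).+2) - 2 * Ex (fun x => F (W x).+1) + Ex (fun x => F (W x)).
  by rewrite ExD ExB ExZ.
have -> : Ex (fun x => (up_rate x - u) ^+ 2 * F (W x).+2) =
  Ex (fun x => up_rate x ^+ 2 * F (W x).+2) - 2 * u * Ex (fun x => up_rate x * F (W x).+2)
  + u ^+ 2 * Ex (fun x => F (W x).+2).
  by generalize u => v; rewrite -!ExZ -ExB -ExD; apply: eq_Ex => x; ring.
have -> : Ex (fun x => (up_rate x - u) * (down_rate x - u) * F (W x).+1) =
  Ex (fun x => up_rate x * down_rate x * F (W x).+1) - u * Ex (fun x => up_rate x * F (W x).+1)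
  - u * Ex (fun x => down_rate x * F (W x).+1) + u ^+ 2 * Ex (fun x => F (W x).+1).
  by generalize u => v; rewrite -!ExZ -!ExB -ExD; apply: eq_Ex => x; ring.
have -> : Ex (fun x => (down_rate x - u) ^+ 2 * F (W x)) =
  Ex (fun x => down_rate x ^+ 2 * F (W x)) - 2 * u * Ex (fun x => down_rate x * F (W x))
  + u ^+ 2 * Ex (fun x => F (W x)).
  by generalize u => v; rewrite -!ExZ -ExB -ExD; apply: eq_Ex => x; ring.
have -> : Ex (fun x => (up_rate2 x - up_rate x ^+ 2) * F (W x).+2) =
  Ex (fun x => up_rate2 x * F (W x).+2) - Ex (fun x => up_rate x ^+ 2 * F (W x).+2).
  by rewrite -ExB; apply: eq_Ex => x; ring.
have -> : Ex (fun x => (down_rate2 x - down_rate x ^+ 2) * F (W x)) =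
  Ex (fun x => down_rate2 x * F (W x)) - Ex (fun x => down_rate x ^+ 2 * F (W x)).
  by rewrite -ExB; apply: eq_Ex => x; ring.
rewrite b1 b2 b3 b4; ring.
Qed.

Lemma smoothing_bound (F : nat -> R) : (forall k, `|F k| <= 1) ->
  u ^+ 2 * `|Ex (fun x => F (W x).+2 - 2 * F (W x).+1 + F (W x))| <=
  2 * Var p up_rate + 2 * Var p down_rate + Ex (fun x => `|up_rate2 x - up_rate x ^+ 2|) + Ex (fun x => `|down_rate2 x - down_rate x ^+ 2|).
Proof.
move=> F1.
have F1' (G : cfg -> R) k : (forall x, `|G x * F (k x)| <= `|G x|).
  by move=> x; rewrite normrM ler_piMr.
rewrite -[u ^+ 2]ger0_norm ?sqr_ge0 // -normrM second_difference.
apply: le_trans (ler_normD _ _) _; apply: lerD; last first.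
  by apply: Ex_norm_le => // x; apply: (F1' (fun x => down_rate2 x - down_rate x ^+ 2)).
apply: le_trans (ler_normD _ _) _; apply: lerD; last first.
  by apply: Ex_norm_le => // x; apply: (F1' (fun x => up_rate2 x - up_rate x ^+ 2) (fun x => (W x).+2)).
apply: le_trans (ler_normD _ _) _.
have h1 : `|Ex (fun x => (up_rate x - u) ^+ 2 * F (W x).+2)| <= Var p up_rate.
  apply: Ex_norm_le => // x; apply: le_trans (F1' (fun x => (up_rate x - u) ^+ 2) (fun x => (W x).+2) _) _.
  by rewrite ger0_norm ?sqr_ge0.
have h2 : `|Ex (fun x => (down_rate x - u) ^+ 2 * F (W x))| <= Var p down_rate.
  apply: Ex_norm_le => // x; apply: le_trans (F1' (fun x => (down_rate x - u) ^+ 2) W _) _.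
  by rewrite Ex_down_rate ger0_norm ?sqr_ge0.
have h3 : `|Ex (fun x => (up_rate x - u) * (down_rate x - u) * F (W x).+1)| <= (Var p up_rate + Var p down_rate) / 2.
  rewrite /Var -ExD mulrC -ExZ.
  apply: Ex_norm_le => // x; apply: le_trans (F1' (fun x => (up_rate x - u) * (down_rate x - u)) (fun x => (W x).+1) _) _.
  rewrite Ex_down_rate -/u ler_norml; apply/andP; split.
    have := sqr_ge0 ((up_rate x - u) + (down_rate x - u)); lra.
  have := sqr_ge0 ((up_rate x - u) - (down_rate x - u)); lra.
have := ler_normB (Ex (fun x => (up_rate x - u) ^+ 2 * F (W x).+2))
  (2 * Ex (fun x => (up_rate x - u) * (down_rate x - u) * F (W x).+1)).
rewrite (normrM 2) (ger0_norm (ler0n R 2)); lra.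
Qed.

(** For triangles, the number of present edges that share exactly one vertex with [e]. *)
Definition deg e x : nat := \sum_(t | e \in tri t) \sum_(f in tri t :\ e) x f.

Definition cowedges e f x : nat :=
  \sum_(t | (e \in tri t) && (f \in tri t)) on (tri t :\ f :\ e) x.

Lemma wedges_dif e f x : f != e ->
  wedges f (upd x e true) = (wedges f (upd x e false) + cowedges e f x)%N.
Proof.
move=> fe; rewrite /wedges (bigID (fun t => e \in tri t)).
rewrite [in RHS](bigID (fun t => e \in tri t)) /=.
rewrite [X in _ = (X + _ + _)%N]big1 => [|t /andP[ft et]]; last first.
  by rewrite on_upd_false // !inE eq_sym fe.
rewrite add0n addnC; congr (_ + _)%N.
  by apply: eq_bigr => t /andP[ft et]; rewrite !on_upd // !inE (negbTE et) andbF.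
rewrite /cowedges; apply: eq_big => [t|t _]; first by rewrite andbC.
by rewrite on_upd_true.
Qed.

(** An indicator moves by at most 1, and here only if [cowedges e f x] is nonzero. *)
Lemma single_dif e f x : f != e ->
  `|(single f (upd x e true))%:R - (single f (upd x e false))%:R| <= (cowedges e f x)%:R :> R.
Proof.
move=> fe; rewrite /single (wedges_dif _ fe).
case: (cowedges e f x) => [|c]; first by rewrite addn0 subrr normr0.
apply: (@le_trans _ _ 1); last by rewrite ler1n.
by do 2!case: (_ == 1%N); rewrite ?subrr ?normr0 ?subr0 ?sub0r ?normrN ?normr1.
Qed.

Lemma card_link t e : e \in tri t -> #|tri t :\ e| = 2%N.
Proof. by move=> et; have := cardsD1 e (tri t); rewrite et tri3 add1n => -[<-]. Qed.

Lemma tri_pair t e : e \in tri t ->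
  exists a b, [/\ a != b, a \in tri t :\ e, b \in tri t :\ e & tri t :\ e = [set a; b]].
Proof.
move=> et; have /eqP/cards2P[a [b [ab H]]] := card_link et; exists a, b; split => //; rewrite H !inE eqxx ?orbT //.
Qed.

Lemma exchange_cowedges e x (c : E -> nat) :
  (\sum_(f | f != e) c f * cowedges e f x =
   \sum_(t | e \in tri t) \sum_(f in tri t :\ e) c f * on (tri t :\ f :\ e) x)%N.
Proof.
rewrite /cowedges; under eq_bigr do rewrite big_distrr /= big_mkcond.
rewrite exchange_big /= [RHS]big_mkcond; apply: eq_bigr => t _.
rewrite -big_mkcondr /=; case: ifP => et; last by rewrite big_pred0 // => f; rewrite andbF.
by apply: eq_bigl => f; rewrite !inE.
Qed.

(** Removing [e] and [f] from a triple leaves its third edge, and as [f] runs over the two edges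
    other than [e], so does that third edge. *)
Lemma sum_cowedges e x : (\sum_(f | f != e) cowedges e f x = deg e x)%N.
Proof.
have := exchange_cowedges e x (fun=> 1%N).
under eq_bigr do rewrite mul1n; move=> ->.
apply: eq_bigr => t et; have [a [b [ab _ _ H]]] := tri_pair et.
under eq_bigr do rewrite mul1n setDDC.
rewrite H !big_setU1 ?inE // !big_set1 pair_rem // setUC pair_rem 1?eq_sym //.
by rewrite /= !on1 addnC.
Qed.

Lemma sum_cowedges_on e x : (\sum_(f | f != e) x f * cowedges e f x = 2 * wedges e x)%N.
Proof.
rewrite exchange_cowedges /wedges big_distrr; apply: eq_bigr => t et.
have [a [b [ab ae be H]]] := tri_pair et.
have aux f : f \in tri t :\ e -> (x f * on (tri t :\ f :\ e) x)%N = on (tri t :\ e) x.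
  move=> ft; rewrite mulnb -on1 -onU setDDC; congr (nat_of_bool (on _ x)).
  by rewrite setD1K.
rewrite (eq_bigr (fun=> on (tri t :\ e) x : nat)) => [|f]; last exact: aux.
by rewrite sum_nat_const H cards2 ab.
Qed.

(** The term of [e] itself contributes at most p. Any other term changes only through [single f], at
    cost p times [cowedges e f x], and these costs add up to the degree. *)
Lemma dif_up_rate e x : `|dif e up_rate x| <= p * (1 + (deg e x)%:R).
Proof.
rewrite /dif /up_rate -sumrB (bigD1 e) //=; apply: le_trans (ler_normD _ _) _.
rewrite mulrDr mulr1; apply: lerD.
  rewrite /up !upd_same !single_upd /= mulr0 mul0r sub0r normrN mulr1 normrM ger0_norm //.
  by rewrite ler_piMr //; case: single; rewrite ?normr1 ?normr0.
apply: le_trans (ler_norm_sum _ _ _) _.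
rewrite -sum_cowedges natr_sum mulr_sumr; apply: ler_sum => f fe.
rewrite /up !updE (negbTE fe) -mulrBr normrM; apply: ler_pM => //; last exact: single_dif.
by rewrite ger0_norm ?mulr_ge0 // ler_piMr //; case: (x f).
Qed.

(** A term f now counts only if f is present, so [sum_cowedges_on] yields twice the wedges instead
    of the degree; this gain replaces the small factor p of the up rate. *)
Lemma dif_down_rate e x : `|dif e down_rate x| <= 3 * (wedges e x)%:R.
Proof.
rewrite /dif /down_rate -sumrB (bigD1 e) //=; apply: le_trans (ler_normD _ _) _.
have -> : 3 * (wedges e x)%:R = (wedges e x)%:R + (2 * wedges e x)%:R :> R.
  by rewrite natrM; ring.
apply: lerD.
  rewrite /down !upd_same !single_upd /= mulr0 mul0r subr0 mulr1 normrM ger0_norm //.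
  apply: (@le_trans _ _ `|(single e x)%:R|); first by rewrite ler_piMl // gerBl.
  by rewrite /single ger0_norm // ler_nat; case: eqP => // ->.
apply: le_trans (ler_norm_sum _ _ _) _.
rewrite -sum_cowedges_on natr_sum; apply: ler_sum => f fe.
rewrite /down !updE (negbTE fe) -mulrBr normrM natrM; apply: ler_pM => //; last exact: single_dif.
by rewrite ger0_norm ?mulr_ge0 // ler_piMl // gerBl.
Qed.

(** The difference is the sum over e of [up e x] times the change of the total up rate caused by
    switching e on. *)
Lemma up_rate2_error x : `|up_rate2 x - up_rate x ^+ 2| <= \sum_e p ^+ 2 * ((wedges e x)%:R * (1 + (deg e x)%:R)).
Proof.
rewrite expr2 {2}/up_rate mulr_suml -sumrB; apply: le_trans (ler_norm_sum _ _ _) _.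
apply: ler_sum => e _; rewrite -mulrBr /up.
case: (boolP (x e)) => xe /=; rewrite ?mulr0 ?mul0r ?normr0 ?mulr1.
  by rewrite mulr_ge0 ?exprn_ge0 // mulr_ge0 // addr_ge0.
have -> : up_rate (upd x e true) - up_rate x = dif e up_rate x by rewrite /dif (upd_eq (negbTE xe)).
rewrite expr2 -!mulrA normrM (ger0_norm p0); apply: ler_wpM2l => //.
rewrite [leRHS]mulrCA normrM; apply: ler_pM => //; last exact: dif_up_rate.
by rewrite ger0_norm // /single ler_nat; case: eqP => // ->.
Qed.

Lemma down_rate2_error x : `|down_rate2 x - down_rate x ^+ 2| <= \sum_e 3 * ((x e)%:R * (wedges e x)%:R).
Proof.
rewrite expr2 {2}/down_rate mulr_suml -sumrB; apply: le_trans (ler_norm_sum _ _ _) _.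
apply: ler_sum => e _; rewrite -mulrBr /down.
case: (boolP (x e)) => xe; rewrite ?mulr0 ?mul0r ?normr0 ?mulr0 // mulr1 mul1r.
have -> : down_rate (upd x e false) - down_rate x = - dif e down_rate x by rewrite /dif opprB (upd_eq xe).
rewrite normrM normrN; apply: le_trans (dif_down_rate e x).
rewrite ler_piMl // normrM ger0_norm //; case: single; rewrite ?normr0 ?mulr0 //.
by rewrite normr1 mulr1 gerBl.
Qed.

(** * Moments of the local counts and the mean rate *)

Lemma sum_const_tri e (a : R) : \sum_(t | e \in tri t) a = r%:R * a.
Proof.
rewrite -(trireg e) mulr_natl -sumr_const; apply: eq_bigl => t.
by rewrite inE.
Qed.

(** An edge of A other than [e] shares at most one triple with [e], so A adds at most #|A| to the
    degree; the 2 r places around [e] add p each. *)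
Lemma Ex_on_deg A e : Ex (fun x => (on A x)%:R * (deg e x)%:R) <=
  p ^+ #|A| * (#|A|%:R + 2 * r%:R * p).
Proof.
rewrite (@eq_Ex _ _ _ _ (fun x => \sum_(t | e \in tri t) \sum_(f in tri t :\ e)
   (on (A :|: [set f]) x)%:R)); last first.
  move=> x; rewrite /deg natr_sum mulr_sumr; apply: eq_bigr => t _.
  rewrite natr_sum mulr_sumr; apply: eq_bigr => f _.
  by rewrite onU on1 -mulnb natrM.
rewrite Ex_sum (eq_bigr (fun t => \sum_(f in tri t :\ e) p ^+ #|A :|: [set f]|)); last first.
  by move=> t _; rewrite Ex_sum; apply: eq_bigr => f _; rewrite Ex_on.
apply: (@le_trans _ _ (\sum_(t | e \in tri t) \sum_(f in tri t :\ e)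
    (p ^+ #|A| * ((f \in A)%:R + p)))).
  apply: ler_sum => t _; apply: ler_sum => f _; rewrite setUC cardsU1.
  case: (f \in A) => /=; last by rewrite add0r add1n exprSr.
  by rewrite add0n mulrDr mulr1 lerDl mulr_ge0 ?exprn_ge0.
rewrite (eq_bigr (fun t => p ^+ #|A| * (\sum_(f in tri t :\ e) (f \in A)%:R)
    + p ^+ #|A| * (2 * p))); last first.
  move=> t et; rewrite -mulr_sumr -mulrDr big_split /=; congr (_ * (_ + _)).
  by rewrite sumr_const card_link // mulr_natl.
rewrite big_split /= sum_const_tri -mulr_sumr.
have -> : p ^+ #|A| * (#|A|%:R + 2 * r%:R * p) =
  p ^+ #|A| * #|A|%:R + r%:R * (p ^+ #|A| * (2 * p)) by ring.
rewrite lerD2r.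
apply: ler_wpM2l; rewrite ?exprn_ge0 //.
under eq_bigr do rewrite big_mkcond.
rewrite exchange_big /= -sum1_card natr_sum [leRHS]big_mkcond; apply: ler_sum => f _.
case: (boolP (f \in A)) => fA; last by rewrite big1 // => t _; rewrite if_same.
rewrite -big_mkcondr /= -natr_sum ler_nat sum1dep_card.
case: (eqVneq f e) => [->|fe].
  by rewrite eq_card0 // => t; rewrite !inE eqxx andbF.
have := card_pair_le trilin fe; congr (_ <= _)%N; apply: eq_card => t.
by rewrite !inE fe andbC.
Qed.

Lemma Ex_deg_sqr e : Ex (fun x => (deg e x)%:R ^+ 2) <= 2 * r%:R * p * (1 + 2 * r%:R * p).
Proof.
rewrite (@eq_Ex _ _ _ _ (fun x => \sum_(t | e \in tri t) \sum_(f in tri t :\ e)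
   (on [set f] x)%:R * (deg e x)%:R)); last first.
  move=> x; rewrite expr2 {1}/deg natr_sum mulr_suml; apply: eq_bigr => t _.
  by rewrite natr_sum mulr_suml; apply: eq_bigr => f _; rewrite on1.
rewrite Ex_sum (_ : 2 * r%:R * p * _ = r%:R * (2 * (p ^+ 1 * (1 + 2 * r%:R * p)))); last by ring.
rewrite -(sum_const_tri e); apply: ler_sum => t et.
have h f : Ex (fun x => (on [set f] x)%:R * (deg e x)%:R) <= p ^+ 1 * (1 + 2 * r%:R * p).
  by have := Ex_on_deg [set f] e; rewrite cards1.
apply: (@le_trans _ _ (\sum_(f in tri t :\ e) p ^+ 1 * (1 + 2 * r%:R * p))).
  by rewrite Ex_sum; apply: ler_sum => f _; exact: h.
by rewrite sumr_const card_link // -[leLHS]mulr_natl.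
Qed.

Lemma wedgesE e x : (wedges e x)%:R = \sum_(t | e \in tri t) (on (tri t :\ e) x)%:R :> R.
Proof. by rewrite natr_sum. Qed.

Lemma Ex_wedges e : Ex (fun x => (wedges e x)%:R) = r%:R * p ^+ 2.
Proof.
rewrite (eq_Ex _ (wedgesE e)) Ex_sum -(sum_const_tri e).
by apply: eq_bigr => t et; rewrite Ex_on card_link.
Qed.

Lemma Ex_wedges_deg e : Ex (fun x => (wedges e x)%:R * (deg e x)%:R)
  <= r%:R * p ^+ 2 * (2 + 2 * r%:R * p).
Proof.
rewrite (@eq_Ex _ _ _ _ (fun x => \sum_(t | e \in tri t) (on (tri t :\ e) x)%:R * (deg e x)%:R)).
  rewrite Ex_sum -mulrA -(sum_const_tri e); apply: ler_sum => t et.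
  by have := Ex_on_deg (tri t :\ e) e; rewrite card_link.
by move=> x; rewrite wedgesE mulr_suml.
Qed.

Lemma Ex_on_wedges e : Ex (fun x => (x e)%:R * (wedges e x)%:R) = r%:R * p ^+ 3.
Proof.
rewrite (@eq_Ex _ _ _ _ (fun x => \sum_(t | e \in tri t) (on (tri t) x)%:R)).
  by rewrite Ex_sum -(sum_const_tri e); apply: eq_bigr => t _; rewrite Ex_on tri3.
move=> x; rewrite wedgesE mulr_sumr; apply: eq_bigr => t et.
by rewrite -{2}(setD1K et) onU on1 -mulnb natrM.
Qed.

Lemma link_disjoint e t s : t != s -> e \in tri t -> e \in tri s ->
  [disjoint tri t :\ e & tri s :\ e].
Proof.
move=> ts et es; apply/pred0P => f /=; rewrite !inE; apply/negbTE/negP.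
case/andP => /andP[fe ft] /andP[_ fs].
by move/eqP: ts; apply; apply: (tri_uniq trilin fe).
Qed.

(** What distinct triples leave after removal of [e] is disjoint, so the off-diagonal terms are p^4;
    the diagonal gives the 1. *)
Lemma Ex_wedges_sqr e : Ex (fun x => (wedges e x)%:R ^+ 2)
  <= r%:R * p ^+ 2 * (1 + r%:R * p ^+ 2).
Proof.
rewrite (@eq_Ex _ _ _ _ (fun x => \sum_(t | e \in tri t) \sum_(s | e \in tri s)
   (on ((tri t :\ e) :|: (tri s :\ e)) x)%:R)); last first.
  move=> x; rewrite expr2 wedgesE mulr_suml; apply: eq_bigr => t _.
  by rewrite mulr_sumr; apply: eq_bigr => s _; rewrite onU -mulnb natrM.
rewrite Ex_sum -mulrA -(sum_const_tri e); apply: ler_sum => t et.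
rewrite Ex_sum mulrDr mulr1 mulrCA -exprD -(sum_const_tri e).
rewrite (bigD1 t) //= Ex_on setUid card_link // lerD2l.
rewrite [leRHS](bigD1 t) //= -[leLHS]add0r; apply: lerD; first exact: exprn_ge0.
apply: ler_sum => s /andP[es st]; rewrite Ex_on.
have d : [disjoint tri t :\ e & tri s :\ e] by apply: link_disjoint; rewrite // eq_sym.
by rewrite cardsU (disjoint_setI0 d) cards0 subn0 !card_link.
Qed.

Lemma Ex_no_wedge e (l : seq T) : uniq l -> {in l, forall t, e \in tri t} ->
  Ex (fun x => \prod_(t <- l) (1 - (on (tri t :\ e) x)%:R)) = (1 - p ^+ 2) ^+ size l.
Proof.
elim: l => [|t l IH] /=.
  by move=> _ _; rewrite (@eq_Ex _ _ _ _ (fun=> 1)) ?Ex_cst // => x; rewrite big_nil.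
case/andP => tl ul le.
have et : e \in tri t by apply: le; rewrite mem_head.
have le' : {in l, forall t, e \in tri t} by move=> s sl; apply: le; rewrite inE sl orbT.
have E1 : 1 - p ^+ 2 = Ex (fun x => 1 - (on (tri t :\ e) x)%:R).
  by rewrite ExB Ex_cst Ex_on card_link.
rewrite exprS -(IH ul le') E1.
rewrite -(@Ex_indep _ _ _ (tri t :\ e) (fun x => 1 - (on (tri t :\ e) x)%:R)).
- by apply: eq_Ex => x; rewrite big_cons.
- by move=> x y xy; rewrite (depon_on _ (subxx _) xy).
- move=> x y xy; rewrite big_seq [RHS]big_seq; apply: eq_bigr => s sl; congr (1 - _).
  apply: (depon_on R (S := ~: (tri t :\ e))) xy; rewrite -disjoints_subset.
  apply: link_disjoint => //; last exact: le'.
  by apply: contraNneq tl => <-.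
Qed.

(** Exactly one wedge: some t contributes and no other does, which are disjoint events over t. The
    product form is suited to independence over disjoint edge sets. *)
Lemma singleE e x : (single e x)%:R = \sum_(t | e \in tri t) (on (tri t :\ e) x)%:R *
  \prod_(s <- rem t (enum [set s | e \in tri s])) (1 - (on (tri s :\ e) x)%:R) :> R.
Proof.
have aux t : e \in tri t ->
   wedges e x = (on (tri t :\ e) x + \sum_(s <- rem t (enum [set s | e \in tri s])) on (tri s :\ e) x)%N.
  move=> et; rewrite rem_filter ?enum_uniq // big_filter big_enum_cond /=.
  rewrite /wedges (bigD1 t) //=; congr (_ + _)%N; apply: eq_bigl => s.
  by rewrite !inE.
have P (l : seq T) : \prod_(s <- l) (1 - (on (tri s :\ e) x)%:R) =
   ((\sum_(s <- l) on (tri s :\ e) x)%N == 0%N)%:R :> R.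
  elim: l => [|s l IH]; first by rewrite !big_nil.
  rewrite !big_cons IH addn_eq0; case: (on _ x) => /=; first by rewrite subrr mul0r.
  by rewrite subr0 mul1r.
rewrite (eq_bigr (fun t => (on (tri t :\ e) x)%:R * (single e x)%:R)); last first.
  move=> t et; rewrite P /single (aux t et).
  by case: (on _ x); rewrite /= ?mul0r ?add1n ?eqSS.
rewrite -mulr_suml -wedgesE -natrM /single.
by case: eqP => [->|]; rewrite ?muln0.
Qed.

(** The probability that a binomial variable with parameters r and p^2 equals one. *)
Lemma Ex_single e : Ex (fun x => (single e x)%:R) = r%:R * (p ^+ 2 * (1 - p ^+ 2) ^+ r.-1).
Proof.
rewrite (eq_Ex _ (singleE e)) Ex_sum -(sum_const_tri e); apply: eq_bigr => t et.
set l := rem t _.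
have ul : uniq l by rewrite rem_uniq // enum_uniq.
have le : {in l, forall s, (s != t) && (e \in tri s)}.
  by move=> s; rewrite mem_rem_uniq ?enum_uniq // !inE mem_enum inE.
have szl : size l = r.-1.
  by rewrite size_rem ?mem_enum ?inE // -cardE trireg.
rewrite -szl -(@Ex_no_wedge e) //; last by move=> s /le/andP[].
have -> : p ^+ 2 = Ex (fun x => (on (tri t :\ e) x)%:R) by rewrite Ex_on card_link.
rewrite (@Ex_indep _ _ _ (tri t :\ e) (fun x => (on (tri t :\ e) x)%:R)) //.
- exact: depon_on.
- move=> x y xy; rewrite big_seq [RHS]big_seq; apply: eq_bigr => s /le/andP[st es].
  congr (1 - _); apply: (depon_on R (S := ~: (tri t :\ e))) xy; rewrite -disjoints_subset.
  exact: link_disjoint.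
Qed.

Lemma Ex_up_rate : u = (p * (1 - p)) * (#|E|%:R * r%:R * (p ^+ 2 * (1 - p ^+ 2) ^+ r.-1)).
Proof.
rewrite /u /up_rate Ex_sum (eq_bigr (fun=> p * (1 - p) * (r%:R * (p ^+ 2 * (1 - p ^+ 2) ^+ r.-1)))).
  by rewrite sumr_const -[LHS]mulr_natl; ring.
move=> e _; rewrite /up.
rewrite (@Ex_indep _ _ p [set e] (fun x => p * (~~ x e)%:R) (fun x => (single e x)%:R)).
- rewrite Ex_single; congr (_ * _); rewrite ExZ; congr (_ * _).
  have -> : 1 - p = Ex (fun x => 1 - (on [set e] x)%:R).
    by rewrite ExB Ex_cst Ex_on cards1.
  by apply: eq_Ex => x; rewrite on1; case: (x e); rewrite ?subrr ?subr0.
- by move=> x y xy; rewrite xy // inE.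
- move=> x y xy; congr ((_ == _)%:R); apply: eq_bigr => t et.
  have : (on (tri t :\ e) x)%:R = (on (tri t :\ e) y)%:R :> R.
    apply: (depon_on R (S := ~: [set e])) xy.
    by rewrite subsetC setDE setCI setCK subsetUr.
  by move/eqP; rewrite eqr_nat => /eqP.
Qed.

Lemma card_flags : (#|E| * r = 3 * #|T|)%N.
Proof.
transitivity (\sum_(e : E) \sum_(t : T | e \in tri t) 1)%N.
  rewrite (eq_bigr (fun=> r)) ?sum_nat_const // => e _.
  by rewrite sum1dep_card trireg.
rewrite (exchange_big_dep xpredT) //= (eq_bigr (fun=> 3%N)).
  by rewrite sum_nat_const mulnC.
by move=> t _; rewrite sum1_card tri3.
Qed.

Variable K : R.
Hypothesis rp2 : r%:R * p ^+ 2 <= K.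
Hypothesis r_gt0 : (0 < r)%N.
Let lam := #|T|%:R * p ^+ 3.

Let card_flagsR : #|E|%:R * r%:R = 3 * #|T|%:R :> R.
Proof. by rewrite -!natrM card_flags. Qed.

Lemma sum_const_E (a : R) : \sum_(e : E) a = #|E|%:R * a.
Proof. by rewrite sumr_const -[LHS]mulr_natl. Qed.

Let K0 : 0 <= K.
Proof. by apply: le_trans rp2; rewrite mulr_ge0 // exprn_ge0. Qed.

Lemma Var_up_rate_le : Var p up_rate <= (18 + 24 * K) * lam.
Proof.
apply: le_trans (efron_stein p01 _) _.
apply: (@le_trans _ _ (\sum_(e : E) p ^+ 3 * (2 + 2 * (2 * r%:R * p * (1 + 2 * r%:R * p))))).
  apply: ler_sum => e _.
  have h : Ex (fun x => dif e up_rate x ^+ 2) <=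
     p ^+ 2 * (2 + 2 * (2 * r%:R * p * (1 + 2 * r%:R * p))).
    apply: (@le_trans _ _ (Ex (fun x => p ^+ 2 * (2 + 2 * (deg e x)%:R ^+ 2)))).
      apply: le_Ex => // x; apply: le_trans (sqr_le (dif_up_rate e x)) _.
      rewrite exprMn; apply: ler_wpM2l; rewrite ?exprn_ge0 //.
      have := sqr_ge0 (1 - (deg e x)%:R : R); lra.
    rewrite ExZ ExD ExZ Ex_cst; apply: ler_wpM2l; rewrite ?exprn_ge0 //.
    by rewrite lerD2l; apply: ler_wpM2l => //; exact: Ex_deg_sqr.
  rewrite [p ^+ 3]exprS -[leRHS]mulrA; apply: ler_pM; last exact: h.
  - by rewrite mulr_ge0.
  - by apply: Ex_ge0 => // x; exact: sqr_ge0.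
  - by rewrite ler_piMr // gerBl.
rewrite sum_const_E; have cf := card_flagsR.
have -> : #|E|%:R * (p ^+ 3 * (2 + 2 * (2 * r%:R * p * (1 + 2 * r%:R * p)))) =
  2 * #|E|%:R * p ^+ 3 + (#|E|%:R * r%:R) * p ^+ 3 * (4 * p + 8 * (r%:R * p ^+ 2)) by ring.
(* As r >= 1, the number of edges is at most #|E| r = 3 #|T|. *)
have h1 : 2 * #|E|%:R * p ^+ 3 <= 2 * (3 * #|T|%:R) * p ^+ 3.
  by rewrite -cf ler_wpM2r ?exprn_ge0 // ler_wpM2l // ler_peMr // ler1n.
have h2 : (#|E|%:R * r%:R) * p ^+ 3 * (4 * p + 8 * (r%:R * p ^+ 2)) <=
   (#|E|%:R * r%:R) * p ^+ 3 * (4 + 8 * K).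
  by apply: ler_wpM2l; [rewrite mulr_ge0 ?exprn_ge0 // mulr_ge0|move: p1 rp2; lra].
apply: le_trans (lerD h1 h2) _; rewrite cf /lam; lra.
Qed.

Lemma Var_down_rate_le : Var p down_rate <= (27 + 27 * K) * lam.
Proof.
apply: le_trans (efron_stein p01 _) _.
apply: (@le_trans _ _ (\sum_(e : E) p * (9 * (r%:R * p ^+ 2 * (1 + K))))).
  apply: ler_sum => e _; apply: ler_pM.
  - by rewrite mulr_ge0.
  - by apply: Ex_ge0 => // x; exact: sqr_ge0.
  - by rewrite ler_piMr // gerBl.
  apply: (@le_trans _ _ (Ex (fun x => 9 * (wedges e x)%:R ^+ 2))).
    apply: le_Ex => // x; apply: le_trans (sqr_le (dif_down_rate e x)) _.
    by rewrite exprMn; lra.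
  rewrite ExZ; apply: ler_wpM2l => //; apply: le_trans (Ex_wedges_sqr e) _.
  by apply: ler_wpM2l; [rewrite mulr_ge0 // exprn_ge0|rewrite lerD2l].
rewrite sum_const_E.
have -> : #|E|%:R * (p * (9 * (r%:R * p ^+ 2 * (1 + K)))) =
  (#|E|%:R * r%:R) * (9 * p ^+ 3 * (1 + K)) by ring.
rewrite card_flagsR /lam le_eqVlt; apply/orP; left; apply/eqP; ring.
Qed.

Lemma Ex_up_rate2_error : Ex (fun x => `|up_rate2 x - up_rate x ^+ 2|) <= (9 + 6 * K) * lam.
Proof.
apply: le_trans (le_Ex p01 up_rate2_error) _; rewrite Ex_sum.
apply: (@le_trans _ _ (\sum_(e : E) p ^+ 2 * (r%:R * p ^+ 2 * (3 + 2 * r%:R * p)))).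
  apply: ler_sum => e _; rewrite ExZ; apply: ler_wpM2l; rewrite ?exprn_ge0 //.
  rewrite (@eq_Ex _ _ _ _ (fun x => (wedges e x)%:R + (wedges e x)%:R * (deg e x)%:R)).
    by rewrite ExD Ex_wedges; have := Ex_wedges_deg e; lra.
  by move=> x; rewrite mulrDr mulr1.
rewrite sum_const_E.
have -> : #|E|%:R * (p ^+ 2 * (r%:R * p ^+ 2 * (3 + 2 * r%:R * p))) =
  (#|E|%:R * r%:R) * p ^+ 3 * (3 * p + 2 * (r%:R * p ^+ 2)) by ring.
rewrite card_flagsR (_ : (9 + 6 * K) * lam = 3 * #|T|%:R * p ^+ 3 * (3 + 2 * K)).
  by apply: ler_wpM2l; [rewrite mulr_ge0 ?exprn_ge0 // mulr_ge0|move: p1 rp2; lra].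
by rewrite /lam; ring.
Qed.

Lemma Ex_down_rate2_error : Ex (fun x => `|down_rate2 x - down_rate x ^+ 2|) <= 9 * lam.
Proof.
apply: le_trans (le_Ex p01 down_rate2_error) _; rewrite Ex_sum.
rewrite (eq_bigr (fun=> 3 * (r%:R * p ^+ 3))) => [|e _]; last by rewrite ExZ Ex_on_wedges.
rewrite sum_const_E.
have -> : #|E|%:R * (3 * (r%:R * p ^+ 3)) = 3 * (#|E|%:R * r%:R) * p ^+ 3 by ring.
by rewrite card_flagsR /lam le_eqVlt; apply/orP; left; apply/eqP; ring.
Qed.

Theorem second_difference_ntri (F : nat -> R) (delta : R) :
  (forall k, `|F k| <= 1) -> p <= 1 / 2 ->
  0 <= delta -> delta <= (1 - p ^+ 2) ^+ r.-1 -> 0 < lam ->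
  delta ^+ 2 * lam * `|Ex (fun x => F (W x).+2 - 2 * F (W x).+1 + F (W x))| <= 48 * (1 + K).
Proof.
move=> F1 p2 d0 dr l0; have := smoothing_bound F1.
set X := `|Ex _| => h.
(* 108 (1 + K) is the total of the four bounds, the two variances having weight 2. *)
have {}h : u ^+ 2 * X <= 108 * (1 + K) * lam.
  apply: le_trans h _; have := Var_up_rate_le; have := Var_down_rate_le.
  have := Ex_up_rate2_error; have := Ex_down_rate2_error; lra.
(* The mean rate is 3 lam (1 - p) (1 - p^2)^(r-1), and 1 - p >= 1/2. Squaring 3/2 gives 9/4, and 108
   / (9/4) = 48. *)
have hu : 3 / 2 * lam * delta <= u.
  rewrite Ex_up_rate card_flagsR.
  have -> : p * (1 - p) * (3 * #|T|%:R * (p ^+ 2 * (1 - p ^+ 2) ^+ r.-1)) =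
    3 * lam * ((1 - p) * (1 - p ^+ 2) ^+ r.-1) by rewrite /lam; ring.
  have : delta / 2 <= (1 - p) * (1 - p ^+ 2) ^+ r.-1.
    by rewrite [leRHS]mulrC; apply: ler_pM => //; lra.
  have := ltW l0; nra.
have hu2 : 9 / 4 * lam ^+ 2 * delta ^+ 2 * X <= 108 * (1 + K) * lam.
  apply: le_trans h; apply: ler_wpM2r; first exact: normr_ge0.
  have -> : 9 / 4 * lam ^+ 2 * delta ^+ 2 = (3 / 2 * lam * delta) ^+ 2 by field.
  apply: sqr_le; rewrite ger0_norm //; apply: mulr_ge0 => //; apply: mulr_ge0; last exact: ltW.
  by rewrite divr_ge0.
rewrite -(ler_pM2l l0); lra.
Qed.

End Smoothing.

(** * Triangles of a graph as a triple system on its edges *)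

Section Graph.
Variable n : nat.

Definition triple : finType :=
  {t : 'I_n * 'I_n * 'I_n | (t.1.1 < t.1.2)%N && (t.1.2 < t.2)%N}.
Implicit Types (t s : triple) (e f : edge n).

Definition mk_edge (i j : 'I_n) (ij : (i < j)%N) : edge n :=
  exist (fun e : 'I_n * 'I_n => (e.1 < e.2)%N) (i, j) ij.
Definition mk_triple (i j k : 'I_n) (h : (i < j)%N && (j < k)%N) : triple :=
  exist (fun t : 'I_n * 'I_n * 'I_n => (t.1.1 < t.1.2)%N && (t.1.2 < t.2)%N) (i, j, k) h.

Lemma triple_lt12 t : ((val t).1.1 < (val t).1.2)%N.
Proof. by case/andP: (valP t). Qed.
Lemma triple_lt23 t : ((val t).1.2 < (val t).2)%N.
Proof. by case/andP: (valP t). Qed.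
Lemma triple_lt13 t : ((val t).1.1 < (val t).2)%N.
Proof. exact: ltn_trans (triple_lt12 t) (triple_lt23 t). Qed.

Definition edge12 t : edge n := mk_edge (triple_lt12 t).
Definition edge23 t : edge n := mk_edge (triple_lt23 t).
Definition edge13 t : edge n := mk_edge (triple_lt13 t).
Definition sides t : {set edge n} := [set edge12 t; edge23 t; edge13 t].

Lemma in_sides e t : (e \in sides t) =
  [|| val e == ((val t).1.1, (val t).1.2), val e == ((val t).1.2, (val t).2)
    | val e == ((val t).1.1, (val t).2)].
Proof. by rewrite !inE orbA -!val_eqE. Qed.

Lemma card_sides t : #|sides t| = 3.
Proof.
case/andP: (valP t) => h1 h2.
rewrite /sides setUC cardsU1 cards2 !inE -!val_eqE /= !xpair_eqE.
have -> : ((val t).1.1 == (val t).1.2) = false by rewrite -val_eqE ltn_eqF.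
have -> : ((val t).1.2 == (val t).2) = false by rewrite -val_eqE ltn_eqF.
have -> : ((val t).2 == (val t).1.2) = false by rewrite -val_eqE gtn_eqF.
by rewrite !andbF.
Qed.

Lemma sides_linear t s : t != s -> (#|sides t :&: sides s| <= 1)%N.
Proof.
move=> ts; apply/card_le1_eqP => e f; rewrite !inE => /andP[et es] /andP[ft fs].
apply/eqP/negPn/negP => ef; move/eqP: ts; apply; apply/val_inj.
move: et es ft fs ef; rewrite ?inE -!val_eqE /=.
case: t s e f => [[[i j] k] /= ht] [[[i' j'] k'] /= hs] [[a b] /= ab] [[c d] /= cd].
rewrite !xpair_eqE -!val_eqE /= => et es ft fs ef.
have [h1 h2 h3] : [/\ i = i' :> nat, j = j' :> nat & k = k' :> nat] by split; lia.
by congr (_, _, _); apply/val_inj.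
Qed.

(** The vertex of t opposite to [e], meaningful when [e] is a side of t. *)
Definition third e t := if val e == ((val t).1.1, (val t).1.2) then (val t).2 else
  if val e == ((val t).1.2, (val t).2) then (val t).1.1 else (val t).1.2.

Lemma third_inj e : {in [set t | e \in sides t] &, injective (third e)}.
Proof.
move=> t s; rewrite !inE -!val_eqE /third /=.
case: t s e => [[[i j] k] /= ht] [[[i' j'] k'] /= hs] [[a b] /= ab].
rewrite !xpair_eqE -!val_eqE /= => et es H; apply/val_inj => /=.
have [h1 h2 h3] : [/\ i = i' :> nat, j = j' :> nat & k = k' :> nat].
  by move: H; do ?[case: ifP => ?]; move=> H; have {}H := congr1 val H; simpl in H; split; lia.
by congr (_, _, _); apply/val_inj.
Qed.

Lemma third_notin e t : e \in sides t -> third e t \notin [set (val e).1; (val e).2].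
Proof.
rewrite in_sides /third !inE; case: t e => [[[i j] k] /= ht] [[a b] /= ab].
by rewrite !xpair_eqE -!val_eqE /=; do ?[case: ifP => ?]; move=> ?; lia.
Qed.

Lemma third_surj e v : v \notin [set (val e).1; (val e).2] ->
  exists2 t, t \in [set t | e \in sides t] & v = third e t.
Proof.
case: e => [[a b] /= ab]; rewrite !inE -!val_eqE /= => vab.
have tac (i j k : 'I_n) (h : (i < j)%N && (j < k)%N) :
   (exist _ (a, b) ab : edge n) \in sides (mk_triple h) ->
   v = third (exist _ (a, b) ab) (mk_triple h) :> nat ->
   exists2 t, t \in [set t | (exist _ (a, b) ab : edge n) \in sides t]
     & v = third (exist _ (a, b) ab) t.
  by move=> h1 h2; exists (mk_triple h); [rewrite inE|apply/val_inj].
have [h1|h1] := ltnP v a.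
  have h : (v < a)%N && (a < b)%N by rewrite h1.
  apply: (tac _ _ _ h); rewrite ?in_sides /third /= ?eqxx ?orbT //.
  by rewrite !xpair_eqE -!val_eqE /=; do ?[case: ifP => ?]; lia.
have [h2|h2] := ltnP v b.
  have h : (a < v)%N && (v < b)%N by lia.
  apply: (tac _ _ _ h); rewrite ?in_sides /third /= ?eqxx ?orbT //.
  by rewrite !xpair_eqE -!val_eqE /=; do ?[case: ifP => ?]; lia.
have h : (a < b)%N && (b < v)%N by lia.
by apply: (tac _ _ _ h); rewrite ?in_sides /third /= ?eqxx ?orbT.
Qed.

(** The opposite vertex identifies the triples on [e] with the vertices off [e]. *)
Lemma card_edge_triples e : #|[set t | e \in sides t]| = (n - 2)%N.
Proof.
rewrite -(card_in_imset (@third_inj e)).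
have -> : third e @: [set t | e \in sides t] = ~: [set (val e).1; (val e).2].
  apply/setP => v; rewrite inE; apply/imsetP/idP; last exact: third_surj.
  by case=> t; rewrite inE => /third_notin h ->.
rewrite cardsCs setCK card_ord cards2.
have : ((val e).1 < (val e).2)%N := valP e.
by rewrite -val_eqE; case: eqP => //= ->; rewrite ltnn.
Qed.

Lemma card_edge : #|edge n| = 'C(n, 2).
Proof.
rewrite card_sig -sum1_card -bin2_sum big_mkord.
rewrite (eq_bigr (fun j : 'I_n => \sum_(i < n | (i < j)%N) 1)%N).
  by rewrite (exchange_big_dep xpredT) //= pair_big_dep /=; apply: eq_bigl => -[].
by move=> j _; rewrite -(big_ord_widen n (fun=> 1%N)) ?sum1_card ?card_ord // ltnW.
Qed.

Lemma card_triple : (6 * #|triple| = n * n.-1 * (n - 2))%N.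
Proof.
have := card_flags card_sides card_edge_triples; rewrite card_edge => H.
have : (2 * 'C(n, 2) = n * n.-1)%N by rewrite -(mul_bin_diag n 1) bin1.
nia.
Qed.

Lemma card_triple_bounds : (4 <= n)%N ->
  (n ^ 3 <= 24 * #|triple|)%N /\ (#|triple| <= n ^ 3)%N.
Proof. by move=> n4; have := card_triple; split; nia. Qed.

Lemma adj_exist (g : graph n) (i j : 'I_n) (ij : (i < j)%N) :
  adj g i j = g (mk_edge ij).
Proof.
rewrite /adj; case: insubP => [u _ uE|]; last by rewrite ij.
by congr (g _); apply/val_inj.
Qed.

Lemma trianglesE (g : graph n) : triangles g = ntri sides g.
Proof.
rewrite /triangles /ntri.
have -> : (\sum_t on (sides t) g = #|[set t : triple | on (sides t) g]|)%N.
  by rewrite -sum1_card [RHS]big_mkcond; apply: eq_bigr => t _; rewrite inE; case: on.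
rewrite -(card_imset _ val_inj); apply: eq_card => t.
have onE (s : triple) : on (sides s) g = [&& adj g (val s).1.1 (val s).1.2,
    adj g (val s).1.2 (val s).2 & adj g (val s).1.1 (val s).2].
  rewrite (adj_exist g (triple_lt12 s)) (adj_exist g (triple_lt23 s)).
  by rewrite (adj_exist g (triple_lt13 s)) /sides !onU !on1 andbA.
apply/idP/imsetP; rewrite classical_sets.in_setE /=.
  case/and5P => h1 h2 a1 a2 a3.
  have h : (t.1.1 < t.1.2)%N && (t.1.2 < t.2)%N by rewrite h1.
  exists (mk_triple h); last by case: t h {h1 h2 a1 a2 a3} => [[]].
  by rewrite inE onE; apply/and3P.
case=> s; rewrite inE onE => /and3P[g1 g2 g3] ->; case/andP: (valP s) => h1 h2.
by apply/and5P; split.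
Qed.

End Graph.

From mathcomp Require Import all_classical all_reals all_analysis.
Import Order.TTheory GRing.Theory Num.Theory numFieldNormedType.Exports.
Local Open Scope ring_scope.
Local Open Scope classical_set_scope.

(** * Landau-Kolmogorov inequalities *)

Section LandauKolmogorov.
Variable R : realType.
Implicit Types (f : nat -> R) (A B X : R).

(** An l1 bound through partial sums, so that it includes summability. *)
Definition l1le f A := forall N, \sum_(0 <= j < N) `|f j| <= A.
Definition fd f k := f k.+1 - f k.

Lemma l1le_ge0 f A : l1le f A -> 0 <= A.
Proof. by move/(_ 0%N); rewrite big_geq. Qed.

Lemma l1le_shift f A i N : l1le f A -> \sum_(0 <= j < N) `|f (j + i)%N| <= A.
Proof.
move=> fA; apply: le_trans (fA (N + i)%N).
rewrite (@big_cat_nat _ _ _ i 0 (N + i)%N) ?leq_addl //=.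
have -> : \sum_(i <= j < N + i) `|f j| = \sum_(0 <= j < N) `|f (j + i)%N|.
  by rewrite -{1}[i]add0n big_addn addnK.
rewrite lerDr.
by apply: sumr_ge0.
Qed.

Lemma fd_drift f j h : `|f (j + h)%N - f j| <= \sum_(0 <= i < h) `|fd f (j + i)%N|.
Proof.
elim: h => [|h IH]; first by rewrite addn0 subrr normr0 big_geq.
rewrite big_nat_recr //= addnS.
have -> : f (j + h).+1 - f j = (f (j + h)%N - f j) + fd f (j + h)%N by rewrite /fd; ring.
by apply: le_trans (ler_normD _ _) _; rewrite lerD2r.
Qed.

Lemma taylor2 f j h : `|f (j + h)%N - f j - h%:R * fd f j| <=
  h%:R * \sum_(0 <= i < h) `|fd (fd f) (j + i)%N|.
Proof.
elim: h => [|h IH]; first by rewrite addn0 subrr !mul0r subr0 normr0.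
have -> : f (j + h.+1)%N - f j - h.+1%:R * fd f j =
  (f (j + h)%N - f j - h%:R * fd f j) + (fd f (j + h)%N - fd f j).
  by rewrite addnS -natr1 /fd; ring.
apply: le_trans (ler_normD _ _) _; rewrite big_nat_recr //=.
have := fd_drift (fd f) j h; have := normr_ge0 (fd (fd f) (j + h)%N).
have := ler0n R h; rewrite -natr1; nra.
Qed.

Lemma landau_kolmogorov2 f A B h : l1le f A -> l1le (fd (fd f)) B ->
  l1le (fun j => h%:R * fd f j) (2 * A + h%:R ^+ 2 * B).
Proof.
move=> fA fB N.
apply: (@le_trans _ _ (\sum_(0 <= j < N) (`|f (j + h)%N| + `|f (j + 0)%N| +
   h%:R * \sum_(0 <= i < h) `|fd (fd f) (j + i)%N|))).
  apply: ler_sum => j _; have := taylor2 f j h.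
  have := ler_normB (f (j + h)%N - f j) (f (j + h)%N - f j - h%:R * fd f j).
  rewrite opprB addrC subrK addn0; have := ler_normB (f (j + h)%N) (f j).
  set a := `|_|; set b := `|_|; set c := `|_ - _|; lra.
rewrite !big_split /= -mulr_sumr exchange_big_nat /=.
have h1 := l1le_shift h N fA; have h0 := l1le_shift 0 N fA.
have : \sum_(0 <= i < h) \sum_(0 <= j < N) `|fd (fd f) (j + i)%N| <= h%:R * B.
  apply: (@le_trans _ _ (\sum_(0 <= i < h) B)).
    by apply: ler_sum => i _; exact: l1le_shift.
  by rewrite sumr_const_nat subn0 mulr_natl.
move/(ler_wpM2l (ler0n R h)); rewrite mulrA -expr2; lra.
Qed.

Lemma landau_kolmogorov3 f A B h : (0 < h)%N -> l1le f A -> l1le (fd (fd (fd f))) B ->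
  l1le (fd f) (4 * A / h%:R + 8 * h%:R ^+ 2 * B) /\
  l1le (fd (fd f)) (2 * A / h%:R ^+ 2 + 8 * h%:R * B).
Proof.
move=> h0 fA fB; set c := 2 * A / h%:R + 4 * h%:R ^+ 2 * B.
have hR : 0 < h%:R :> R by rewrite ltr0n.
(* A crude bound: it shows that the norm of [fd f] is finite, so that half of it can be absorbed
   below. *)
have f1 : l1le (fd f) (2 * A).
  move=> N; apply: (@le_trans _ _ (\sum_(0 <= j < N) (`|f (j + 1)%N| + `|f (j + 0)%N|))).
    by apply: ler_sum => j _; rewrite addn0 addn1 /fd ler_normB.
  by rewrite big_split /=; have := l1le_shift 1 N fA; have := l1le_shift 0 N fA; lra.
(* The step 4 h gives X the coefficient 1 / (2 h), which becomes the 1/2 of [step1] after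
   multiplication by h. *)
have step2 X : l1le (fd f) X -> l1le (fd (fd f)) (X / (2 * h%:R) + 4 * h%:R * B).
  move=> fX N; have /(_ N) := landau_kolmogorov2 (4 * h)%N fX fB.
  have p4 : 0 < (4 * h)%:R :> R by rewrite ltr0n muln_gt0.
  under eq_bigr do rewrite normrM (ger0_norm (ltW p4)).
  rewrite -mulr_sumr -ler_pdivlMl // natrM => /le_trans; apply.
  by rewrite le_eqVlt; apply/orP; left; apply/eqP; field; rewrite gt_eqF.
have step1 X : l1le (fd f) X -> l1le (fd f) (c + X / 2).
  move=> fX N; have /(_ N) := landau_kolmogorov2 h fA (step2 _ fX).
  under eq_bigr do rewrite normrM (ger0_norm (ltW hR)).
  rewrite -mulr_sumr -ler_pdivlMl // => /le_trans; apply.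
  by rewrite /c le_eqVlt; apply/orP; left; apply/eqP; field; rewrite gt_eqF.
(* With steps h and 4 h the two-term inequalities bound the norm of [fd f] by
   [c] plus half of itself. *)
have L1 : l1le (fd f) (2 * c).
  pose S := [set \sum_(0 <= j < N) `|fd f j| | N in [set: nat]].
  have S0 : S !=set0 by exists (\sum_(0 <= j < 0) `|fd f j|); exists 0%N.
  have fS : l1le (fd f) (sup S).
    move=> N; apply: ub_le_sup; last by exists N.
    by exists (2 * A) => _ [n _ <-]; exact: f1.
  have : sup S <= c + sup S / 2.
    by apply: ge_sup => // _ [n _ <-]; exact: step1.
  move=> H N; apply: le_trans (fS N) _; lra.
split; first by move=> N; apply: le_trans (L1 N) _; rewrite /c; lra.
move=> N; apply: le_trans (step2 _ L1 N) _.
by rewrite /c le_eqVlt; apply/orP; left; apply/eqP; field; rewrite gt_eqF.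
Qed.

End LandauKolmogorov.

(** * Stein's method for the Poisson distribution *)

Section Poisson.
Variables (R : realType) (lam : R).
Hypothesis lam_gt0 : 0 < lam.
(* Unqualified, [poisson_pmf] is the one of mathcomp-analysis. *)
Local Notation pi := (Defs.poisson_pmf lam).
Implicit Types (h g H : nat -> R).

(** The sum is strict: the distribution function at n is [cdf n.+1]. *)
Definition cdf n := \sum_(0 <= i < n) pi i.
Definition psum H n := \sum_(0 <= i < n) pi i * H i.
Definition vanishes (u : nat -> R) := forall e, 0 < e -> exists N, forall M, (N <= M)%N -> `|u M| <= e.

Lemma pois_gt0 k : 0 < pi k.
Proof. by rewrite /Defs.poisson_pmf divr_gt0 ?mulr_gt0 ?expR_gt0 ?exprn_gt0 // ltr0n fact_gt0. Qed.

Lemma pois_rec k : lam * pi k = k.+1%:R * pi k.+1.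
Proof.
rewrite /Defs.poisson_pmf factS natrM exprS; field.
by rewrite nat1r !pnatr_eq0 -lt0n fact_gt0.
Qed.

Lemma cdfS n : cdf n.+1 = cdf n + pi n.
Proof. by rewrite /cdf big_nat_recr. Qed.

Lemma psumS H n : psum H n.+1 = psum H n + pi n * H n.
Proof. by rewrite /psum big_nat_recr. Qed.

Lemma cdf_cvg : cdf n @[n --> \oo] --> (1 : R).
Proof.
have -> : cdf = (fun n => expR (- lam) * series (exp_coeff lam) n).
  apply/funext => n; rewrite /cdf /series /= mulr_sumr; apply: eq_bigr => i _.
  by rewrite /Defs.poisson_pmf /exp_coeff /= mulrA.
have -> : (1 : R) = expR (- lam) * expR lam by rewrite -expRD addNr expR0.
apply: cvgMr; exact: (is_cvg_series_exp_coeff lam).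
Qed.

Lemma cdf_nd : {homo cdf : m n / (m <= n)%N >-> m <= n}.
Proof.
by apply: homo_leq => [//|x y z|n]; [exact: le_trans|rewrite cdfS lerDl ltW ?pois_gt0].
Qed.

Lemma cdf_le1 n : cdf n <= 1.
Proof.
have <- := cvg_lim (@Rhausdorff R) cdf_cvg.
apply: nondecreasing_cvgn_le; first exact: cdf_nd.
by apply/cvg_ex; exists 1; exact: cdf_cvg.
Qed.

Lemma tail_vanishes : vanishes (fun n => 1 - cdf n).
Proof.
move=> e e0; have /cvgrPdist_le/(_ e e0) [N _ HN] := cdf_cvg.
by exists N => M NM; exact: HN.
Qed.

Lemma vanishes_le u v c : vanishes u -> (forall n, `|v n.+1| <= c * `|u n|) -> vanishes v.
Proof.
move=> uv vc e e0; have c1 : 0 < `|c| + 1 by rewrite ltr_wpDl.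
have [N HN] := uv (e / (`|c| + 1)) (divr_gt0 e0 c1).
exists N.+1 => [[//|M] NM]; apply: le_trans (vc M) _.
have := HN M NM; rewrite ler_pdivlMr // => h; apply: le_trans h.
by rewrite mulrC ler_wpM2l // (le_trans (ler_norm c)) // lerDl.
Qed.

Lemma vanishesD u v : vanishes u -> vanishes v -> vanishes (fun n => u n + v n).
Proof.
move=> hu hv e e0; have e2 : 0 < e / 2 by rewrite divr_gt0.
have [N HN] := hu _ e2; have [N' HN'] := hv _ e2.
exists (maxn N N') => M; rewrite geq_max => /andP[/HN h1 /HN' h2].
by apply: le_trans (ler_normD _ _) _; lra.
Qed.

Lemma vanishesN u : vanishes u -> vanishes (fun n => - u n).
Proof. by move=> hu e /hu [N HN]; exists N => M /HN; rewrite normrN. Qed.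

Lemma vanishes_ge0 u m : vanishes u -> (forall M, (m <= M)%N -> u M <= u m) -> 0 <= u m.
Proof.
move=> hu um; rewrite leNgt; apply/negP => um0.
have e0 : 0 < - u m / 2 by rewrite divr_gt0 // oppr_gt0.
have [N HN] := hu _ e0; have := HN (maxn N m) (leq_maxl _ _).
have := um (maxn N m) (leq_maxr _ _); rewrite ler_norml => h /andP[h1 _]; lra.
Qed.

Lemma kpois_vanishes : vanishes (fun k => k%:R * pi k).
Proof.
apply: (vanishes_le (c := lam) tail_vanishes) => n.
rewrite -pois_rec normrM (ger0_norm (ltW lam_gt0)) ler_wpM2l ?(ltW lam_gt0) //.
rewrite !ger0_norm ?subr_ge0 ?cdf_le1 ?(ltW (pois_gt0 _)) //.
by rewrite lerBrDl -cdfS cdf_le1.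
Qed.

Lemma mean_telescope k : psum (fun i => lam - i%:R) k = k%:R * pi k.
Proof.
elim: k => [|k IH]; first by rewrite /psum big_geq // mul0r.
by rewrite psumS IH -pois_rec; ring.
Qed.

(** In [mean_telescope] every lam - i with i < k is at least lam - k. *)
Lemma mills_lower k : (lam - k%:R) * cdf k <= k%:R * pi k.
Proof.
rewrite -mean_telescope /cdf mulr_sumr /psum big_nat_cond [leRHS]big_nat_cond.
apply: ler_sum => i /andP[/andP[_ ik] _]; rewrite mulrC ler_wpM2l ?(ltW (pois_gt0 _)) //.
by rewrite lerB // ler_nat ltnW.
Qed.

(** The same comparison on the upper tail, without infinite sums: the difference of the two sides
    has increments (M - k) times the mass at M, so from k on it increases to its limit 0. *)
Lemma mills_upper k : (k%:R - lam) * (1 - cdf k) <= k%:R * pi k.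
Proof.
pose u n := (k%:R - lam) * (1 - cdf n) - n%:R * pi n.
have uv : vanishes u.
  apply: vanishesD; last exact: vanishesN kpois_vanishes.
  move=> e e0; have c1 : 0 < `|k%:R - lam| + 1 by rewrite ltr_wpDl.
  have [N HN] := tail_vanishes (divr_gt0 e0 c1).
  exists N => M /HN; rewrite ler_pdivlMr // normrM => h; apply: le_trans h.
  by rewrite mulrC ler_wpM2l // lerDl.
suff : 0 <= - u k by rewrite /u opprB subr_ge0.
apply: (vanishes_ge0 (vanishesN uv)) => M.
elim: M => [|M IH]; first by rewrite leqn0 => /eqP ->.
rewrite leq_eqVlt => /orP[/eqP -> //|]; rewrite ltnS => kM.
apply: le_trans (IH kM); rewrite lerN2 /u cdfS -pois_rec -subr_ge0.
have -> : (k%:R - lam) * (1 - (cdf M + pi M)) - lam * pi M -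
  ((k%:R - lam) * (1 - cdf M) - M%:R * pi M) = (M%:R - k%:R) * pi M by ring.
by rewrite mulr_ge0 ?(ltW (pois_gt0 _)) // subr_ge0 ler_nat.
Qed.

(** While H is nonnegative the partial sums are sums of nonnegative terms; once H is negative they
    decrease to 0. *)
Lemma psum_ge0 H : (forall i, H i.+1 <= H i) -> vanishes (psum H) -> forall k, 0 <= psum H k.
Proof.
move=> Hn Hv k.
have Hm i j : (i <= j)%N -> H j <= H i.
  elim: j => [|j IH]; first by rewrite leqn0 => /eqP ->.
  rewrite leq_eqVlt => /orP[/eqP -> //|]; rewrite ltnS => /IH; exact: le_trans.
have [Hk|Hk] := leP 0 (H k).
  rewrite /psum big_nat_cond; apply: sumr_ge0 => i /andP[/andP[_ ik] _].
  by rewrite mulr_ge0 ?(ltW (pois_gt0 _)) // (le_trans Hk) // Hm // ltnW.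
apply: vanishes_ge0 Hv _; elim=> [|M IH]; first by rewrite leqn0 => /eqP ->.
rewrite leq_eqVlt => /orP[/eqP -> //|]; rewrite ltnS => kM.
apply: le_trans (IH kM); rewrite psumS gerDl mulr_ge0_le0 ?(ltW (pois_gt0 _)) //.
by rewrite (le_trans (Hm _ _ kM)) // ltW.
Qed.

(* h + id and h - id are monotone, and the Stein solution for the identity is constant. *)
Lemma psum_lipschitz h c : (forall k, `|h k.+1 - h k| <= 1) ->
  vanishes (psum (fun i => h i - c)) ->
  forall k, `|psum (fun i => h i - c) k| <= k%:R * pi k.
Proof.
move=> hl hv k.
have key (s : R) : `|s| = 1 -> 0 <= s * psum (fun i => h i - c) k + k%:R * pi k.
  move=> s1.
  have E1 n : s * psum (fun i => h i - c) n + n%:R * pi n =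
      psum (fun i => s * (h i - c) + (lam - i%:R)) n.
    rewrite -mean_telescope /psum mulr_sumr -big_split; apply: eq_bigr => i _ /=.
    by ring.
  rewrite E1; apply: psum_ge0 => [i|].
    have : `|s * (h i.+1 - h i)| <= 1 by rewrite normrM s1 mul1r.
    rewrite ler_norml -natr1 => /andP[_]; lra.
  have -> : psum (fun i => s * (h i - c) + (lam - i%:R)) =
    (fun n => s * psum (fun i => h i - c) n + n%:R * pi n).
    by apply/funext => n; rewrite E1.
  apply: vanishesD; last exact: kpois_vanishes.
  by move=> e /hv [N HN]; exists N => M /HN; rewrite normrM s1 mul1r.
have k1 := key 1 (normr1 _); have k2 := key (-1) (normrN1 _).
by rewrite ler_norml; apply/andP; split; lra.
Qed.

Lemma stein_rec_psum g H : (forall k, lam * g k.+1 - k%:R * g k = H k) ->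
  forall k, k%:R * pi k * g k = psum H k.
Proof.
move=> gH; elim=> [|k IH]; first by rewrite /psum big_geq // !mul0r.
by rewrite psumS -IH -gH -pois_rec; ring.
Qed.

(** The partial sum of H up to k is at most b times either tail. The two Mills bounds turn this into
    |(k - lam) g k| <= b, and lam times the difference of g is H k + (k - lam) g k. *)
Lemma stein_bounded g H b b' :
  (forall k, lam * g k.+1 - k%:R * g k = H k) ->
  (forall k, `|H k| <= b) -> (forall k, `|g k| <= b') ->
  forall k, (0 < k)%N -> `|g k.+1 - g k| <= 2 * b / lam.
Proof.
move=> gH Hb gb k k0; have gS := stein_rec_psum gH.
have pk : 0 < k%:R * pi k by rewrite mulr_gt0 ?pois_gt0 // ltr0n.
have b0 : 0 <= b by apply: le_trans (Hb 0%N).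
have lo : `|psum H k| <= b * cdf k.
  apply: le_trans (ler_norm_sum _ _ _) _; rewrite /cdf mulr_sumr; apply: ler_sum => i _.
  by rewrite normrM (gtr0_norm (pois_gt0 _)) mulrC ler_wpM2r ?(ltW (pois_gt0 _)).
have dist M : (k <= M)%N -> `|psum H M - psum H k| <= b * (cdf M - cdf k).
  elim: M => [|M IH]; first by rewrite leqn0 => /eqP ->; rewrite !subrr normr0 mulr0.
  rewrite leq_eqVlt => /orP[/eqP ->|]; first by rewrite !subrr normr0 mulr0.
  rewrite ltnS => /IH {}IH.
  rewrite psumS addrAC cdfS [cdf M + _ - _]addrAC mulrDr; apply: le_trans (ler_normD _ _) _; apply: lerD => //.
  by rewrite normrM (gtr0_norm (pois_gt0 _)) mulrC ler_wpM2r ?(ltW (pois_gt0 _)).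
(* As g is bounded, the total of the series is 0, and [psum H k] is also minus the sum over i >=
   k. *)
have up : `|psum H k| <= b * (1 - cdf k).
  have v : vanishes (psum H).
    move=> e e0; have c1 : 0 < `|b'| + 1 by rewrite ltr_wpDl.
    have [N HN] := kpois_vanishes (divr_gt0 e0 c1).
    exists N => M /HN; rewrite ler_pdivlMr // => h; rewrite -gS normrM; apply: le_trans h.
    by apply: ler_wpM2l => //; apply: le_trans (gb M) (le_trans (ler_norm b') _); rewrite lerDl.
  rewrite leNgt; apply/negP => hlt.
  have e0 : 0 < (`|psum H k| - b * (1 - cdf k)) / 2 by rewrite divr_gt0 // subr_gt0.
  have [N HN] := v _ e0; have := HN _ (leq_maxl N k); have := dist _ (leq_maxr N k).
  have : b * cdf (maxn N k) <= b by rewrite ler_piMr // cdf_le1.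
  have := ler_normB (psum H (maxn N k)) (psum H (maxn N k) - psum H k).
  rewrite opprB addrC subrK; lra.
have mid : `|(k%:R - lam) * g k| <= b.
  rewrite -(ler_pM2l pk) -{1}(gtr0_norm pk) -normrM mulrCA gS normrM.
  have [kl|kl] := leP k%:R lam.
    have d0 : 0 <= lam - k%:R by rewrite subr_ge0.
    rewrite distrC (ger0_norm d0); apply: le_trans (ler_wpM2l d0 lo) _.
    by rewrite mulrCA mulrC; apply: ler_wpM2r => //; exact: mills_lower.
  have d0 : 0 <= k%:R - lam by rewrite subr_ge0 ltW.
  rewrite (ger0_norm d0); apply: le_trans (ler_wpM2l d0 up) _.
  by rewrite mulrCA mulrC; apply: ler_wpM2r => //; exact: mills_upper.
have -> : g k.+1 - g k = (H k + (k%:R - lam) * g k) / lam.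
  by rewrite -gH; field; rewrite gt_eqF.
rewrite normrM normfV (gtr0_norm lam_gt0) ler_wpM2r ?invr_ge0 ?(ltW lam_gt0) //.
by apply: le_trans (ler_normD _ _) _; have := Hb k; lra.
Qed.

(** By [psum_lipschitz] the solution is bounded by 1. Its difference G solves Stein's equation
    again, with right-hand side h k.+1 - h k + g k.+1, which is at most 2 in absolute value;
    [stein_bounded] then gives 4 / lam. *)
Theorem stein_solution h c : (forall k, `|h k.+1 - h k| <= 1) ->
  vanishes (psum (fun i => h i - c)) ->
  exists g : nat -> R, [/\ forall k, lam * g k.+1 - k%:R * g k = h k - c,
    forall k, `|g k.+1 - g k| <= 2 &
    forall k, `|(g k.+2 - g k.+1) - (g k.+1 - g k)| <= 4 / lam].
Proof.
move=> hl hv; pose g0 k := psum (fun i => h i - c) k / (k%:R * pi k).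
(* Stein's equation leaves [g 0] free; this value makes the second difference vanish at 0. *)
pose g k := if k is 0%N then 2 * g0 1%N - g0 2%N else g0 k.
have nz k : k.+1%:R * pi k.+1 != 0.
  by rewrite mulf_neq0 ?pnatr_eq0 // gt_eqF ?pois_gt0.
have gE k : lam * g k.+1 - k%:R * g k = h k - c.
  rewrite /g /g0 -pois_rec psumS.
  have l0 : lam != 0 by rewrite gt_eqF.
  have p0 : pi k != 0 by rewrite gt_eqF ?pois_gt0.
  case: k p0 => [|k] p0; first by rewrite /psum big_geq // mul0r subr0 add0r; field; rewrite p0 l0.
  by field; rewrite p0 l0 nat1r pnatr_eq0.
have g1 k : `|g k.+1| <= 1.
  rewrite /g /g0 normrM normfV ler_pdivrMr ?normr_gt0 // mul1r.
  apply: le_trans (psum_lipschitz hl hv _) _; exact: ler_norm.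
pose G k := g k.+1 - g k.
have G01 : G 0%N = G 1%N by rewrite /G /g; ring.
have G2 k : `|G k| <= 2.
  have G2S j : `|G j.+1| <= 2.
    by apply: le_trans (ler_normB _ _) _; have := g1 j; have := g1 j.+1; lra.
  by case: k => [|k] //; rewrite G01.
exists g; split => // k.
case: k => [|k].
  rewrite -/(G 1%N) -/(G 0%N) G01 subrr normr0 divr_ge0 //; exact: ltW.
have -> : 4 / lam = 2 * 2 / lam by congr (_ / _); ring.
apply: (@stein_bounded G (fun k => (h k.+1 - h k) + g k.+1) 2 2) => // [j|j].
  have e1 := gE j; have e2 := gE j.+1.
  have -> : h j.+1 - h j = (h j.+1 - c) - (h j - c) by ring.
  by rewrite -e1 -e2 /G -natr1; ring.
by apply: le_trans (ler_normD _ _) _; have := hl j; have := g1 j; lra.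
Qed.

Definition lag (m : nat) (a : nat -> R) j := if (m <= j)%N then a (j - m)%N else 0.

Lemma lag1_pois j : lag 1 pi j = j%:R * pi j / lam.
Proof.
case: j => [|j]; first by rewrite /lag /= !mul0r.
by rewrite /lag /= subn1 -pois_rec mulrAC divff ?mul1r // gt_eqF.
Qed.

Lemma lag2_pois j : lag 2 pi j = j%:R * (j%:R - 1) * pi j / lam ^+ 2.
Proof.
case: j => [|[|j]]; rewrite /lag /=; first by rewrite !mul0r.
  by rewrite subrr mulr0 !mul0r.
rewrite subn2 /= (_ : j.+2%:R - 1 = j.+1%:R); last by rewrite -[in LHS]natr1 addrK.
rewrite [X in _ = X / _]mulrAC -pois_rec -(mulrA lam) [pi j.+1 * _]mulrC -pois_rec.
by field; rewrite gt_eqF.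
Qed.

Lemma second_moment_telescope n :
  psum (fun i => i%:R - (i%:R - lam) ^+ 2) n = n%:R * pi n * (n%:R - 1 - lam).
Proof.
elim: n => [|n IH]; first by rewrite /psum big_geq // !mul0r.
by rewrite psumS IH -pois_rec -natr1; ring.
Qed.

(** The second difference at j is the mass at j times ((j - lam)^2 - j) / lam^2, so its l1 norm is
    at most (variance + mean) / lam^2. *)
Lemma poisson_second_difference N :
  \sum_(0 <= j < N) `|pi j - 2 * lag 1 pi j + lag 2 pi j| <= 2 / lam.
Proof.
have l0 : lam != 0 by rewrite gt_eqF.
(* Beyond 1 + lam the boundary term of [second_moment_telescope] is nonnegative. *)
pose M := (N + (Num.bound (1 + lam)))%N.
have Mlam : 1 + lam <= M%:R.
  apply: le_trans (ltW (archi_boundP _)) _; first by rewrite addr_ge0 // ltW.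
  by rewrite ler_nat leq_addl.
apply: (@le_trans _ _ (\sum_(0 <= j < M) `|pi j - 2 * lag 1 pi j + lag 2 pi j|)).
  rewrite [leRHS](@big_cat_nat _ _ _ N) ?leq_addr //= lerDl.
  by apply: sumr_ge0.
apply: (@le_trans _ _ ((2 * psum (fun i => i%:R) M - psum (fun i => i%:R - (i%:R - lam) ^+ 2) M) / lam ^+ 2)).
  rewrite /psum mulr_sumr -sumrB mulr_suml; apply: ler_sum => j _.
  rewrite lag1_pois lag2_pois.
  have -> : pi j - 2 * (j%:R * pi j / lam) + j%:R * (j%:R - 1) * pi j / lam ^+ 2 =
     pi j / lam ^+ 2 * ((j%:R - lam) ^+ 2 - j%:R) by field.
  have -> : (2 * (pi j * j%:R) - pi j * (j%:R - (j%:R - lam) ^+ 2)) / lam ^+ 2 =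
     pi j / lam ^+ 2 * ((j%:R - lam) ^+ 2 + j%:R) by field.
  have c0 : 0 <= pi j / lam ^+ 2 by rewrite divr_ge0 ?exprn_ge0 ?ltW ?pois_gt0.
  rewrite normrM (ger0_norm c0) ler_wpM2l //.
  by apply: le_trans (ler_normB _ _) _; rewrite !ger0_norm ?sqr_ge0.
have m1 : psum (fun i => i%:R) M <= lam.
  have -> : psum (fun i => i%:R) M = lam * cdf M - psum (fun i => lam - i%:R) M.
    by rewrite /psum /cdf mulr_sumr -sumrB; apply: eq_bigr => i _; ring.
  rewrite mean_telescope; have : lam * cdf M <= lam by rewrite ler_piMr ?cdf_le1 // ltW.
  have : 0 <= M%:R * pi M by rewrite mulr_ge0 // ltW // pois_gt0.
  lra.
have m2 : 0 <= psum (fun i => i%:R - (i%:R - lam) ^+ 2) M.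
  rewrite second_moment_telescope; apply: mulr_ge0; last lra.
  by rewrite mulr_ge0 // ltW // pois_gt0.
have -> : 2 / lam = 2 * lam / lam ^+ 2 by field.
by rewrite ler_wpM2r ?invr_ge0 ?exprn_ge0 ?(ltW lam_gt0) //; lra.
Qed.

End Poisson.

(** * Translated Poisson approximation *)

Section Lag.
Variable R : realType.
Implicit Types (a b : nat -> R).

Definition bd a j := a j - lag 1 a j.

Lemma fd_lag m a : fd (lag m.+1 a) =1 lag m (bd a).
Proof.
move=> j; rewrite /fd /lag ltnS subSS; have [mj|mj] := leqP m j.
  rewrite /bd /lag subn_gt0; case: ltnP => // mj'.
  by rewrite subnS subn1.
by rewrite ltnNge ltnW // subrr.
Qed.

Lemma bd_bd a j : bd (bd a) j = a j - 2 * lag 1 a j + lag 2 a j.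
Proof.
case: j => [|[|j]]; rewrite /bd /lag /=; first by ring.
  by rewrite subnn /=; ring.
by rewrite !subSS !subn0; ring.
Qed.

Lemma l1le_lag m a A : l1le a A -> l1le (lag m a) A.
Proof.
move=> aA N; have [Nm|mN] := leqP N m.
  rewrite big_nat_cond big1 ?(l1le_ge0 aA) // => j /andP[/andP[_ jN] _].
  by rewrite /lag leqNgt (leq_trans jN Nm) normr0.
rewrite (@big_cat_nat _ _ _ m) ?(ltnW mN) //= big_nat_cond big1 ?add0r; last first.
  by move=> j /andP[/andP[_ jm] _]; rewrite /lag leqNgt jm normr0.
rewrite -{1}[m]add0n big_addn; apply: le_trans (aA (N - m)%N).
by apply: ler_sum => j _; rewrite /lag leq_addl addnK.
Qed.

Lemma sum_pick (phi : nat -> R) N k :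
  \sum_(0 <= j < N) phi j * (k == j)%:R = if (k < N)%N then phi k else 0.
Proof.
rewrite big_mkord; case: ifP => kN.
  rewrite (bigD1 (Ordinal kN)) //= eqxx mulr1 big1 ?addr0 // => j jk.
  rewrite (_ : (k == j) = false) ?mulr0 //; apply: contraNF jk => /eqP kj.
  by apply/eqP/val_inj.
rewrite big1 // => j _; rewrite (_ : (k == j) = false) ?mulr0 //.
by apply: contraFF kN => /eqP ->.
Qed.

End Lag.

Section TranslatedPoisson.
Variables (R : realType) (E T : finType) (p : R) (tri : T -> {set E}) (r : nat).
Hypothesis p0 : 0 <= p.
Hypothesis p2 : p <= 1 / 2.
Hypothesis tri3 : forall t, #|tri t| = 3.
Hypothesis trilin : forall t s, t != s -> (#|tri t :&: tri s| <= 1)%N.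
Hypothesis trireg : forall e, #|[set t | e \in tri t]%SET| = r.
Local Notation Ex := (@Ex R E p).
Local Notation W := (ntri tri).
Variables (K delta lam : R) (m : nat).
Hypothesis rp2 : r%:R * p ^+ 2 <= K.
Hypothesis r_gt1 : (1 < r)%N.
Hypothesis delta_gt0 : 0 < delta.
Hypothesis delta_le : delta <= (1 - p ^+ 2) ^+ r.-1.
Let lam0 := #|T|%:R * p ^+ 3.
Hypothesis lam0_gt0 : 0 < lam0.
Let mu := Ex (fun x => (W x)%:R).
Let s2 := Var p (fun x => (W x)%:R).
Hypothesis lamE : lam = mu + m%:R.
Hypothesis s2_lam : s2 <= lam <= s2 + 1.
Local Notation pi := (Defs.poisson_pmf lam).

Let p01 : 0 <= p <= 1.
Proof. by rewrite p0 (le_trans p2) //; lra. Qed.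

Let lam0_le : lam0 <= lam.
Proof.
case/andP: s2_lam => h _; apply: le_trans h.
exact: (Var_ntri_ge p01 tri3 trilin trireg r_gt1 p2).
Qed.

Let lam_gt0 : 0 < lam.
Proof. exact: lt_le_trans lam0_le. Qed.

Let V x := (W x + m)%N.
Let P j := Ex (fun x => (V x == j)%:R).
Let F j := Ex (fun x => (V x <= j)%N%:R).
Let f j := F j - cdf lam j.+1.

Let bd_f : bd f =1 (fun j => P j - pi j).
Proof.
have FS j : F j.+1 = F j + P j.+1.
  rewrite /F /P -ExD; apply: eq_Ex => x; rewrite leq_eqVlt ltnS.
  by case: eqP => [->|] /=; rewrite ?ltnn ?addr0 // add0r.
case=> [|j]; rewrite /bd /lag /=.
  rewrite subr0 /f cdfS /cdf big_geq // add0r; congr (_ - _).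
  by apply: eq_Ex => x; rewrite leqn0.
by rewrite subn1 /= /f FS cdfS; ring.
Qed.

Let lag_P i : lag i P =1 (fun j => Ex (fun x => ((V x + i)%N == j)%:R)).
Proof.
move=> j; rewrite /lag; case: leqP => ij.
  by apply: eq_Ex => x; congr (_%:R); rewrite -(eqn_add2r i) subnK.
rewrite -[LHS](Ex_cst E p 0); apply: eq_Ex => x; rewrite (_ : (_ == _) = false) //.
by apply/negbTE; rewrite neq_ltn (leq_trans ij) ?orbT // leq_addl.
Qed.

(** By duality: phi is the sign of the second difference, cut off at N, and summation by parts moves
    the differences onto phi. *)
Lemma smooth_ntri : l1le (bd (bd P)) (48 * (1 + K) / (delta ^+ 2 * lam0)).
Proof.
move=> N; pose phi j := if (j < N)%N then Num.sg (bd (bd P) j) else 0.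
have phi1 k : `|phi k| <= 1.
  by rewrite /phi; case: ifP; rewrite ?normr0 // normr_sg; case: eqP.
have key : \sum_(0 <= j < N) `|bd (bd P) j| =
   Ex (fun x => phi (W x + m).+2 - 2 * phi (W x + m).+1 + phi (W x + m)%N).
  transitivity (\sum_(0 <= j < N) phi j * bd (bd P) j).
    rewrite big_nat_cond [RHS]big_nat_cond; apply: eq_bigr => j /andP[/andP[_ jN] _].
    by rewrite /phi jN normrEsg.
  transitivity (\sum_(0 <= j < N) Ex (fun x => phi j * ((V x).+2 == j)%:R -
     2 * (phi j * ((V x).+1 == j)%:R) + phi j * (V x == j)%:R)).
    apply: eq_bigr => j _; rewrite bd_bd !lag_P.
    rewrite ExD ExB !ExZ mulrDr mulrBr.
    rewrite (@eq_Ex _ _ _ _ (fun x => ((V x).+1 == j)%:R)); last by move=> x; rewrite addn1.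
    rewrite (@eq_Ex _ _ _ (fun x => ((V x + 2)%N == j)%:R) (fun x => ((V x).+2 == j)%:R)); last first.
      by move=> x; rewrite addn2.
    rewrite -/(P j); ring.
  rewrite -Ex_sum; apply: eq_Ex => x.
  have phiE k : (if (k < N)%N then phi k else 0) = phi k by rewrite /phi; case: (k < N)%N.
  by rewrite big_split /= sumrB -mulr_sumr !sum_pick !phiE.
have := second_difference_ntri p01 tri3 trilin trireg rp2 (ltnW r_gt1)
  (F := fun k => phi (k + m)%N) (fun k => phi1 _) p2 (ltW delta_gt0) delta_le lam0_gt0.
rewrite -key => H.
have d0 : 0 < delta ^+ 2 * lam0 by rewrite mulr_gt0 // exprn_gt0.
rewrite ler_pdivlMr // mulrC; apply: le_trans H.
by rewrite ler_wpM2l ?(ltW d0) // ler_norm.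
Qed.

(** Since lam - V = mu - W, the Stein operator is lam times the difference of g minus (W - mu) g.
    Replacing lam by s2 costs 1 times 2; the rest is [stein_ntri], where the bound 4 / lam cancels
    the factor lam0. *)
Lemma stein_identity_ntri (g : nat -> R) : (forall k, `|g k.+1 - g k| <= 2) ->
  (forall k, `|(g k.+2 - g k.+1) - (g k.+1 - g k)| <= 4 / lam) ->
  `|Ex (fun x => lam * g (V x).+1 - (V x)%:R * g (V x))| <= 2 + 24 * (36 + 6 * K) ^+ 2.
Proof.
move=> g1 g2; pose gm k := g (k + m)%N.
have st := stein_ntri p01 tri3 trilin trireg (g := gm) (fun k => g2 (k + m)%N).
have -> : Ex (fun x => lam * g (V x).+1 - (V x)%:R * g (V x)) =
  (lam - s2) * Ex (fun x => gm (W x).+1 - gm (W x)) -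
  (Ex (fun x => ((W x)%:R - mu) * gm (W x)) - s2 * Ex (fun x => gm (W x).+1 - gm (W x))).
  have -> (a b c : R) : (a - b) * c - (Ex (fun x => ((W x)%:R - mu) * gm (W x)) - b * c) =
     a * c - Ex (fun x => ((W x)%:R - mu) * gm (W x)) by ring.
  rewrite -ExZ -ExB; apply: eq_Ex => x.
  by rewrite /gm /V natrD lamE addSn; ring.
apply: le_trans (ler_normB _ _) _; apply: lerD.
  rewrite normrM -[2]mul1r; apply: ler_pM => //.
    by case/andP: s2_lam => h1 h2; rewrite ger0_norm ?subr_ge0 // lerBlDl.
  rewrite -[2](Ex_cst E p); apply: Ex_norm_le => // x; exact: g1.
apply: le_trans st _; rewrite -/lam0.
have -> : 6 * near_bound p r 6 ^+ 2 * lam0 * (4 / lam) = (24 * near_bound p r 6 ^+ 2) * (lam0 / lam) by ring.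
apply: (@le_trans _ _ (24 * near_bound p r 6 ^+ 2 * 1)).
  apply: ler_wpM2l; first by rewrite mulr_ge0 // sqr_ge0.
  by rewrite ler_pdivrMr // mul1r.
have k0 : 0 <= near_bound p r 6 by exact: near_bound_ge0.
have k1 : near_bound p r 6 <= 36 + 6 * K by rewrite /near_bound; move: rp2; lra.
by rewrite mulr1 ler_wpM2l // lerXn2r ?nnegrE // (le_trans k0 k1).
Qed.

(** Again duality: the increments of h are the signs of f, so h is 1-Lipschitz, and the difference
    of its two expectations is minus the l1 norm of f. *)
Lemma wasserstein_ntri : l1le f (2 + 24 * (36 + 6 * K) ^+ 2).
Proof.
move=> N; pose ep j := Num.sg (f j).
pose h k := \sum_(0 <= j < N) ep j * (j < k)%N%:R.
(* The Poisson mean of h: the mass of the integers above j is 1 - [cdf lam j.+1]. *)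
pose c := \sum_(0 <= j < N) ep j * (1 - cdf lam j.+1).
have ep1 j : `|ep j| <= 1 by rewrite /ep normr_sg; case: eqP.
have hl k : `|h k.+1 - h k| <= 1.
  rewrite /h -sumrB (eq_bigr (fun j => ep j * (k == j)%:R)); last first.
    move=> j _; rewrite -mulrBr ltnS leq_eqVlt (eq_sym j k).
    by case: (eqVneq k j) => [->|_] /=; rewrite ?ltnn ?subr0 ?subrr.
  by rewrite sum_pick; case: ifP => //; rewrite normr0.
have hv : vanishes (psum lam (fun i => h i - c)).
  have E1 M : (N <= M)%N -> psum lam (fun i => h i - c) M =
      - (1 - cdf lam M) * \sum_(0 <= j < N) ep j * cdf lam j.+1.
    move=> NM; rewrite /psum.
    transitivity (\sum_(0 <= j < N) \sum_(0 <= i < M)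
        ep j * (pi i * (j < i)%N%:R - pi i * (1 - cdf lam j.+1))).
      rewrite exchange_big_nat /=; apply: eq_bigr => i _.
      rewrite /h /c -sumrB mulr_sumr; apply: eq_bigr => j _; ring.
    rewrite mulr_sumr big_nat_cond [RHS]big_nat_cond.
    apply: eq_bigr => j /andP[/andP[_ jN] _].
    rewrite -mulr_sumr sumrB -mulr_suml -/(cdf lam M).
    have -> : \sum_(0 <= i < M) pi i * (j < i)%N%:R = cdf lam M - cdf lam j.+1.
      have jM : (j < M)%N by exact: leq_trans NM.
      rewrite (@big_cat_nat _ _ _ j.+1) //= [X in X + _]big_nat_cond big1 ?add0r; last first.
        by move=> i /andP[/andP[_ ij] _]; rewrite ltnNge -ltnS ij mulr0.
      rewrite /cdf [\sum_(0 <= i < M) _](@big_cat_nat _ _ _ j.+1) //= [RHS]addrAC subrr add0r.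
      rewrite big_nat_cond [RHS]big_nat_cond; apply: eq_bigr => i /andP[/andP[ij _] _].
      by rewrite ij mulr1.
    ring.
  move=> e e0; set S := \sum_(0 <= j < N) ep j * cdf lam j.+1 in E1.
  have c1 : 0 < `|S| + 1 by rewrite ltr_wpDl.
  have [N' HN'] := tail_vanishes lam (divr_gt0 e0 c1).
  exists (maxn N N') => M; rewrite geq_max => /andP[NM /HN'].
  rewrite ler_pdivlMr // E1 // normrM normrN => H; apply: le_trans H.
  by rewrite ler_wpM2l // lerDl.
have [g [gE g1 g2]] := stein_solution lam_gt0 hl hv.
have -> : \sum_(0 <= j < N) `|f j| = - Ex (fun x => lam * g (V x).+1 - (V x)%:R * g (V x)).
  rewrite (@eq_Ex _ _ _ _ (fun x => h (V x) - c)) => [|x]; last exact: gE.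
  rewrite ExB Ex_cst /h Ex_sum /c -sumrB -sumrN; apply: eq_bigr => j _.
  rewrite ExZ -mulrBr -mulrN normrEsg; congr (_ * _); rewrite /f opprB.
  have -> : Ex (fun x => (j < V x)%N%:R) = 1 - F j.
    transitivity (Ex (fun x => 1 - (V x <= j)%N%:R)); last by rewrite ExB Ex_cst.
    apply: eq_Ex => x.
    by rewrite ltnNge; case: (V x <= j)%N; rewrite ?subrr ?subr0.
  ring.
by apply: le_trans (stein_identity_ntri g1 g2); rewrite -normrN ler_norm.
Qed.

Let A0 := 2 + 24 * (36 + 6 * K) ^+ 2.
Let B0 := 48 * (1 + K) / delta ^+ 2 + 2.

Theorem translated_poisson_bounds h : (0 < h)%N ->
  (forall N, \sum_(0 <= j < N) `|P j - pi j| <= 4 * A0 / h%:R + 8 * h%:R ^+ 2 * (B0 / lam0)) /\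
  (forall j, `|P j - pi j| <= 2 * A0 / h%:R ^+ 2 + 8 * h%:R * (B0 / lam0)).
Proof.
(* Three leading zeros turn the forward differences of [lag 3 f] into the backward
   differences of [f] extended by zero. *)
move=> h0; pose fh := lag 3 f.
have fhA : l1le fh A0 by apply: l1le_lag; exact: wasserstein_ntri.
have fd1 : fd fh =1 lag 2 (fun j => P j - pi j).
  by move=> j; rewrite /fh fd_lag /lag; case: ifP => // _; exact: bd_f.
have fd3 : fd (fd (fd fh)) =1 (fun j => bd (bd P) j - (pi j - 2 * lag 1 pi j + lag 2 pi j)).
  have e2 : fd (fd fh) =1 lag 1 (bd (fun j => P j - pi j)).
    by move=> j; rewrite {1}/fd !fd1 -/(fd _ _) fd_lag.
  move=> j; rewrite {1}/fd !e2 -/(fd _ _) fd_lag /lag leq0n subn0 !bd_bd /lag.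
  by case: (leqP 1 j) => _; case: (leqP 2 j) => _; ring.
have fhB : l1le (fd (fd (fd fh))) (B0 / lam0).
  move=> N; under eq_bigr do rewrite fd3.
  apply: (@le_trans _ _ (\sum_(0 <= j < N) (`|bd (bd P) j| + `|pi j - 2 * lag 1 pi j + lag 2 pi j|))).
    by apply: ler_sum => j _; exact: ler_normB.
  rewrite big_split /=; have := smooth_ntri N; have := poisson_second_difference lam_gt0 N.
  have : 2 / lam <= 2 / lam0 by rewrite ler_wpM2l // lef_pV2 // posrE.
  have -> : B0 / lam0 = 48 * (1 + K) / (delta ^+ 2 * lam0) + 2 / lam0.
    by rewrite /B0; field; rewrite !gt_eqF.
  lra.
have [l1 l2] := landau_kolmogorov3 h0 fhA fhB; split.
  move=> N; apply: le_trans (l1le_shift 2 N l1); apply: ler_sum => j _.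
  by rewrite fd1 /lag leq_addl addnK.
(* [fd fh] starts at 0, so each value is at most the l1 norm of its differences; the index j + 2
   skips its two leading zeros. *)
move=> j; apply: le_trans (l2 j.+2).
have := fd_drift (fd fh) 0 j.+2; rewrite !fd1 add0n /lag /= subr0 subn2 /=.
move/le_trans; apply; rewrite le_eqVlt; apply/orP; left; apply/eqP.
by apply: eq_bigr => i _; rewrite add0n.
Qed.

End TranslatedPoisson.

(** * Distances between laws on the integers *)

Section IntegerLaws.
Variable R : realType.

Lemma d_loc_le (f g : int -> R) (B : R) :
  (forall j, `|f j - g j| <= B) -> (d_loc f g <= B%:E)%E.
Proof.
move=> fgB; apply: ge_ereal_sup => _ [j _ <-].
by rewrite lee_fin.
Qed.

(** The difference of the laws vanishes below - m, so the sum over the integers becomes a series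
    over the naturals; the factor 1/2 is given away. *)
Lemma d_tv_le (f g : int -> R) (D : nat -> R) (m : nat) (B : R) :
  (forall j : int, `|f j - g j| = if - m%:Z <= j then `|D (absz (j + m%:Z))| else 0) ->
  (forall N, \sum_(0 <= k < N) `|D k| <= B) -> (d_tv f g <= B%:E)%E.
Proof.
move=> fgD DB.
have B0 : 0 <= B by have := DB 0%N; rewrite big_geq.
have key : (\esum_(j in [set: int]) (`|f j - g j|)%:E <= B%:E)%E.
  have -> : \esum_(j in [set: int]) (`|f j - g j|)%:E =
     \esum_(j in [set j : int | - m%:Z <= j]) (`|D (absz (j + m%:Z))|)%:E.
    rewrite [RHS]esum_mkcond; apply: eq_esum => j _; rewrite fgD.
    have -> : (j \in [set j : int | - m%:Z <= j]) = (- m%:Z <= j).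
      by apply/idP/idP; rewrite in_setE.
    by case: ifP.
  rewrite (@reindex_esum _ _ _ [set: nat] _ (fun k : nat => k%:Z - m%:Z)); last first.
    split.
    - by move=> k _ /=; lia.
    - by move=> k l _ _ H; lia.
    - by move=> j /= mj; exists (absz (j + m%:Z)) => //; lia.
  rewrite -nneseries_esumT; last by move=> k; rewrite lee_fin.
  apply: lime_le.
    by apply: is_cvg_nneseries => k _ _; rewrite lee_fin.
  apply: nearW => N; rewrite sumEFin lee_fin; apply: le_trans (DB N).
  by apply: ler_sum => k _; rewrite subrK.
rewrite /d_tv; apply: (@le_trans _ _ ((1 / 2)%:E * B%:E)%E).
  by apply: lee_pmul => //; apply: esum_ge0.
rewrite -EFinM lee_fin; lra.
Qed.

End IntegerLaws.

(** * The triangle count of G(n, p) for fixed n *)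

Section Gnp.
Variables (R : realType) (n : nat) (p : R).
Let W := ntri (@sides n).

Lemma tri_meanE : tri_mean n p = Ex p (fun x => (W x)%:R).
Proof. by apply: eq_bigr => g _; rewrite trianglesE. Qed.

Lemma tri_varE : tri_var n p = Var p (fun x => (W x)%:R).
Proof. by apply: eq_bigr => g _; rewrite tri_meanE trianglesE. Qed.

Lemma tri_pmfE k : tri_pmf n p (Posz k) = Ex p (fun x => (W x == k)%:R).
Proof.
rewrite /tri_pmf big_mkcond; apply: eq_bigr => g _; rewrite trianglesE.
by case: eqP; rewrite ?mulr1 ?mulr0.
Qed.

Lemma tri_tp_dist (m : nat) (j : int) : Num.floor (tri_mean n p - tri_var n p) = - m%:Z ->
  `|tri_pmf n p j - tp_pmf (tri_mean n p) (tri_var n p) j| =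
  if - m%:Z <= j then
    `|Ex p (fun x => ((W x + m)%N == (absz (j + m%:Z)))%:R) -
      Defs.poisson_pmf (tri_mean n p + m%:R) (absz (j + m%:Z))| else 0.
Proof.
move=> fm; rewrite /tp_pmf fm opprK.
case: ifP => mj.
  congr (`|_ - Defs.poisson_pmf _ _|); last by rewrite mulrNz; ring.
  case: j mj => k mj.
    rewrite tri_pmfE; apply: eq_Ex => x; congr (_%:R); congr nat_of_bool.
    by apply/eqP/eqP; lia.
  rewrite -[LHS](Ex_cst (edge n) p 0); apply: eq_Ex => x.
  by case: eqP => //; lia.
case: j mj => [k|k _]; first by lia.
by rewrite subr0 normr0.
Qed.

Variables (K delta : R).
Hypothesis p0 : 0 <= p.
Hypothesis p2 : p <= 1 / 2.
Hypothesis n4 : (4 <= n)%N.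
Hypothesis rp2 : (n - 2)%:R * p ^+ 2 <= K.
Hypothesis delta_gt0 : 0 < delta.
Hypothesis delta_le : delta <= (1 - p ^+ 2) ^+ (n - 2).-1.
Let lam0 := #|triple n|%:R * p ^+ 3.
Hypothesis lam0_gt0 : 0 < lam0.

Let p01 : 0 <= p <= 1.
Proof. by rewrite p0 (le_trans p2) //; lra. Qed.

Lemma tri_var_ge : lam0 <= tri_var n p.
Proof.
rewrite tri_varE; apply: (Var_ntri_ge p01 (@card_sides n) (@sides_linear n) (@card_edge_triples n)) => //.
by rewrite ltn_subRL.
Qed.

Lemma tri_var_le : tri_var n p <= (18 + 6 * K) * lam0.
Proof.
rewrite tri_varE; apply: le_trans (Var_ntri_le p01 (@card_sides n) (@sides_linear n) (@card_edge_triples n)) _.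
apply: ler_wpM2r; first exact: ltW.
rewrite /near_bound; move: rp2; lra.
Qed.

Let A0 := 2 + 24 * (36 + 6 * K) ^+ 2.
Let B0 := 48 * (1 + K) / delta ^+ 2 + 2.

Lemma gnp_bounds h : (0 < h)%N ->
  (d_tv (tri_pmf n p) (tp_pmf (tri_mean n p) (tri_var n p)) <=
     (4 * A0 / h%:R + 8 * h%:R ^+ 2 * (B0 / lam0))%:E)%E /\
  (d_loc (tri_pmf n p) (tp_pmf (tri_mean n p) (tri_var n p)) <=
     (2 * A0 / h%:R ^+ 2 + 8 * h%:R * (B0 / lam0))%:E)%E.
Proof.
move=> h0; set fl := Num.floor (tri_mean n p - tri_var n p).
have meanE : tri_mean n p = lam0.
  by rewrite tri_meanE (Ex_ntri p (@card_sides n)).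
(* The variance is at least the mean, so the translation is to the left and W + m is a natural
   number. *)
have fl0 : fl <= 0.
  by rewrite floor_le0; have := tri_var_ge; rewrite meanE; lra.
have flE : fl = - (absz fl)%:Z by lia.
have := floor_itv (tri_mean n p - tri_var n p); rewrite -/fl flE.
set m := (absz fl) in flE *; rewrite mulrNz intrD mulrNz => /andP[f1 f2].
have fm1 : m%:~R = m%:R :> R by [].
have [|||tv loc] := @translated_poisson_bounds R (edge n) (triple n) p (@sides n) (n - 2)%N
  p0 p2 (@card_sides n) (@sides_linear n) (@card_edge_triples n) K delta
  (tri_mean n p + m%:R) m rp2 _ delta_gt0 delta_le lam0_gt0 _ _ h h0.
- lia.
- by rewrite tri_meanE.
(* lam - s2 is the fractional part gamma of mu - s2. *)
- by rewrite -tri_varE; apply/andP; split; rewrite fm1 in f1 f2; lra.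
have dist j := tri_tp_dist j flE.
split; first exact: d_tv_le dist tv.
apply: d_loc_le => j; rewrite dist; case: ifP => _; first exact: loc.
by apply: le_trans (loc 0%N).
Qed.

End Gnp.

(** * Asymptotics in n *)

Lemma one_minus_pow_ge (R : realType) (x K : R) k : 0 <= x -> x <= 1 / 2 -> k%:R * x <= K ->
  expR (- (2 * K)) <= (1 - x) ^+ k.
Proof.
move=> x0 x2 kxK.
(* For 0 <= x <= 1/2, 1 / (1 - x) <= 1 + 2 x <= exp (2 x). *)
have h : expR (- (2 * x)) <= 1 - x.
  rewrite expRN -[leRHS]invrK lef_pV2 ?posrE ?invr_gt0 ?expR_gt0 ?subr_gt0 //; last lra.
  apply: le_trans (expR_ge1Dx _); rewrite -div1r ler_pdivrMr ?subr_gt0; last lra.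
  nra.
apply: (@le_trans _ _ (expR (- (2 * x)) ^+ k)); last first.
  by rewrite lerXn2r ?nnegrE ?expR_ge0 //; lra.
by rewrite -expRM_natl ler_expR; lra.
Qed.

Theorem theorem14 (R : realType) (p : nat -> R) (alpha c : R) :
  (forall n, 0 <= p n <= 1) ->
  1 / 2 <= alpha -> alpha < 1 -> 0 < c ->
  (fun n : nat => n%:R `^ alpha * p n) @ \oo --> c ->
  (exists c1 c2 : R, 0 < c1 /\ 0 < c2 /\
     \forall n \near \oo,
       c1 * (n%:R ^+ 3 * p n ^+ 3) <= tri_var n (p n) <= c2 * (n%:R ^+ 3 * p n ^+ 3))
  /\
  (exists C : R, \forall n \near \oo,
     (d_tv (tri_pmf n (p n)) (tp_pmf (tri_mean n (p n)) (tri_var n (p n)))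
      <= (C * n%:R `^ (- (1 - alpha)))%:E)%E)
  /\
  (exists C : R, \forall n \near \oo,
     (d_loc (tri_pmf n (p n)) (tp_pmf (tri_mean n (p n)) (tri_var n (p n)))
      <= (C * (Num.sqrt (tri_var n (p n)))^-1 * n%:R `^ (- ((1 - alpha) / 2)))%:E)%E).
Proof.
move=> p01 a2 a1 c0 pc.
(* For large n, n^alpha p <= 2 c, and n <= n^(2 alpha), so n p^2 <= (2 c)^2 = K; [delta] is then the
   lower bound of [one_minus_pow_ge]. *)
pose K := 4 * c ^+ 2; pose delta := expR (- (2 * K)).
have K0 : 0 <= K by rewrite mulr_ge0 // sqr_ge0.
have d0 : 0 < delta by exact: expR_gt0.
have [A A0 AE] : exists2 A : R, 0 <= A & A = 2 + 24 * (36 + 6 * K) ^+ 2.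
  by eexists; last reflexivity; rewrite addr_ge0 // mulr_ge0 // sqr_ge0.
have [B B0 BE] : exists2 B : R, 0 <= B & B = 48 * (1 + K) / delta ^+ 2 + 2.
  eexists; last reflexivity.
  by rewrite addr_ge0 // divr_ge0 ?sqr_ge0 // mulr_ge0 // addr_ge0.
have [s s0 sE] : exists2 s : R, 0 < s & s = 18 + 6 * K.
  by eexists; last reflexivity; lra.
(* 192 = 8 * 24: the mean is at least (n p)^3 / 24, and n p >= (c / 2) n^(1 - alpha). *)
have [b b0 bE] : exists2 b : R, 0 < b & b = c ^+ 3 / 192.
  by eexists; last reflexivity; rewrite divr_gt0 // exprn_gt0.
have near_y : \forall n \near \oo, c / 2 <= n%:R `^ alpha * p n <= 2 * c.
  have c2 : 0 < c / 2 by rewrite divr_gt0.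
  have /cvgrPdist_le/(_ _ c2) := pc; apply: filterS => n.
  by rewrite ler_distlC => /andP[h1 h2]; apply/andP; split; lra.
(* The second condition gives 4 c <= sqrt n <= n^alpha, so that n^alpha p <= 2 c forces p <= 1/2. *)
have near_n : \forall n \near \oo, (4 <= n)%N /\ (4 * c) ^+ 2 <= n%:R :> R.
  near=> n; split; first by near: n; exact: nbhs_infty_ge.
  by near: n; exact: nbhs_infty_ger.
have near_all : \forall n \near \oo, [/\ (4 <= n)%N, 0 < p n <= 1 / 2,
   (n - 2)%:R * p n ^+ 2 <= K, delta <= (1 - p n ^+ 2) ^+ (n - 2).-1 &
   c / 2 * n%:R `^ (1 - alpha) <= n%:R * p n <= 2 * c * n%:R `^ (1 - alpha)].
  apply: filterS2 near_y near_n => n /andP[y1 y2] [n4 nc].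
  have n0 : 0 < n%:R :> R by rewrite ltr0n (leq_trans _ n4).
  set q := n%:R `^ alpha in y1 y2.
  have q0 : 0 < q by exact: powR_gt0.
  have q2 : n%:R <= q ^+ 2.
    rewrite -powR_mulrn ?(ltW q0) // -powRrM -[leLHS]powRr1 ?(ltW n0) //.
    by apply: ler_powR; [rewrite ler1n (leq_trans _ n4)|lra].
  have qc : 4 * c <= q.
    rewrite -(@ler_pXn2r _ 2) ?nnegrE ?(ltW q0) ?mulr_ge0 ?(ltW c0) //.
    exact: le_trans q2.
  have p0 : 0 < p n.
    by rewrite -(pmulr_rgt0 _ q0); apply: lt_le_trans y1; rewrite divr_gt0.
  have p2 : p n <= 1 / 2.
    rewrite -(ler_pM2l q0); apply: le_trans y2 _; lra.
  have np2 : n%:R * p n ^+ 2 <= K.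
    apply: (@le_trans _ _ (q ^+ 2 * p n ^+ 2)); first by rewrite ler_wpM2r ?sqr_ge0.
    have -> : K = (2 * c) ^+ 2 by rewrite /K; ring.
    rewrite -exprMn.
    by rewrite lerXn2r ?nnegrE // mulr_ge0 // ltW.
  have rp2 k : (k <= n)%N -> k%:R * p n ^+ 2 <= K.
    by move=> kn; apply: le_trans np2; rewrite ler_wpM2r ?sqr_ge0 // ler_nat.
  split; rewrite ?p0 ?p2 //; first exact: rp2 (leq_subr _ _).
    apply: one_minus_pow_ge; first exact: sqr_ge0.
      have pn1 : p n <= 1 by case/andP: (p01 n).
      by apply: le_trans p2; rewrite expr2 ler_piMr // ltW.
    by apply: rp2; apply: leq_trans (leq_pred _) (leq_subr _ _).
  have tq : n%:R `^ (1 - alpha) = n%:R / q.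
    by rewrite powRB ?powRr1 ?(ltW n0) // (gt_eqF n0) implybT.
  have np : n%:R * p n = (q * p n) * (n%:R / q) by field; rewrite gt_eqF.
  by rewrite tq np !ler_wpM2r // divr_ge0 // ltW.
have size n : (4 <= n)%N -> (n%:R : R) ^+ 3 / 24 <= #|triple n|%:R /\ #|triple n|%:R <= (n%:R : R) ^+ 3.
  move=> n4; have [h1 h2] := card_triple_bounds n4.
  by rewrite ler_pdivrMr // -!natrX -natrM !ler_nat mulnC; split.
have var_near : \forall n \near \oo, 1 / 24 * (n%:R ^+ 3 * p n ^+ 3) <= tri_var n (p n)
     <= s * (n%:R ^+ 3 * p n ^+ 3).
  apply: filterS near_all => n [n4 /andP[pn0 pn2] rp2 _ _].
  have [s1 s2] := size n n4.
  have p3 : 0 < p n ^+ 3 by rewrite exprn_gt0.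
  have n3 : 0 < n%:R ^+ 3 :> R by rewrite exprn_gt0 // ltr0n (leq_trans _ n4).
  have l0 : 0 < #|triple n|%:R * p n ^+ 3.
    by rewrite mulr_gt0 //; apply: lt_le_trans s1; rewrite divr_gt0.
  apply/andP; split.
    apply: le_trans _ (tri_var_ge (ltW pn0) pn2 n4).
    by rewrite mulrA ler_wpM2r ?(ltW p3) // mulrC mul1r.
  apply: le_trans (tri_var_le (ltW pn0) pn2 rp2 l0) _; rewrite -sE.
  apply: ler_wpM2l; first exact: ltW.
  by rewrite ler_wpM2r ?(ltW p3).
have bounds : \forall n \near \oo, let t := n%:R `^ (1 - alpha) in [/\ 0 < t,
    (d_tv (tri_pmf n (p n)) (tp_pmf (tri_mean n (p n)) (tri_var n (p n)))
      <= ((4 * A + 32 * B / b) / t)%:E)%E,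
    (d_loc (tri_pmf n (p n)) (tp_pmf (tri_mean n (p n)) (tri_var n (p n)))
      <= ((2 * A + 16 * B / b) / t ^+ 2)%:E)%E,
    0 < tri_var n (p n) & tri_var n (p n) <= s * (2 * c) ^+ 3 * t ^+ 3].
  apply: filterS2 near_all var_near => n [n4 /andP[pn0 pn2] rp2 dl /andP[np1 np2]].
  case/andP=> _ v2 t.
  have [s1 s2] := size n n4.
  have t1 : 1 <= t.
    rewrite -(powRr0 n%:R); apply: ler_powR; last lra.
    by rewrite ler1n (leq_trans _ n4).
  have t0 : 0 < t by exact: lt_le_trans t1.
  (* The integer step h lies between t and 2 t, the latter because t >= 1. *)
  pose h := (absz (Num.floor t)).+1.
  have [h1 h2] : t <= h%:R /\ h%:R <= 2 * t.
    have f0 : 0 <= Num.floor t by rewrite floor_ge0 ltW.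
    have E1 : h%:R = (Num.floor t + 1)%:~R :> R.
      by rewrite -[RHS]/(_%:~R) -(gez0_abs f0) -PoszD addn1.
    rewrite E1; split; first by rewrite ltW // floorD1_gt.
    by rewrite intrD; have := floor_le t; lra.
  have hR : 0 < h%:R :> R by rewrite ltr0n.
  pose lam0 := #|triple n|%:R * p n ^+ 3.
  have l1 : b * t ^+ 3 <= lam0.
    apply: (@le_trans _ _ ((n%:R ^+ 3 / 24) * p n ^+ 3)); last first.
      by rewrite ler_wpM2r // exprn_ge0 // ltW.
    have -> : n%:R ^+ 3 / 24 * p n ^+ 3 = (n%:R * p n) ^+ 3 / 24 by rewrite exprMn; field.
    have -> : b * t ^+ 3 = (c / 2 * t) ^+ 3 / 24 by rewrite bE; field.
    have ct0 : 0 <= c / 2 * t by rewrite mulr_ge0 ?(ltW t0) // divr_ge0 // ltW.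
    by rewrite ler_wpM2r ?invr_ge0 // lerXn2r ?nnegrE // (le_trans ct0).
  have l0 : 0 < lam0 by apply: lt_le_trans l1; rewrite mulr_gt0 // exprn_gt0.
  have Bl : B / lam0 <= B / (b * t ^+ 3).
    by rewrite ler_wpM2l // lef_pV2 // posrE mulr_gt0 // exprn_gt0.
  have Bl0 : 0 <= B / lam0 by rewrite divr_ge0 // ltW.
  have hV : h%:R^-1 <= t^-1 by rewrite lef_pV2 // posrE.
  have [tv loc] := @gnp_bounds R n (p n) K delta (ltW pn0) pn2 n4 rp2 d0 dl l0 h isT.
  rewrite -AE -BE in tv loc.
  split => //.
  - apply: le_trans tv _; rewrite lee_fin [leRHS]mulrDl; apply: lerD.
      by rewrite ler_wpM2l // mulr_ge0.
    have h4 : 8 * h%:R ^+ 2 <= 32 * t ^+ 2.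
      have -> : 32 * t ^+ 2 = 8 * (2 * t) ^+ 2 by ring.
      by rewrite ler_wpM2l // lerXn2r ?nnegrE ?mulr_ge0 // ltW.
    apply: le_trans (ler_pM _ Bl0 h4 Bl) _; first by rewrite mulr_ge0 ?sqr_ge0.
    by rewrite le_eqVlt; apply/orP; left; apply/eqP; field; rewrite !gt_eqF.
  - apply: le_trans loc _; rewrite lee_fin [leRHS]mulrDl; apply: lerD.
      rewrite ler_wpM2l ?mulr_ge0 // -!exprVn.
      by rewrite lerXn2r ?nnegrE ?invr_ge0 // ltW.
    have h4 : 8 * h%:R <= 16 * t by lra.
    apply: le_trans (ler_pM _ Bl0 h4 Bl) _; first by rewrite mulr_ge0.
    by rewrite le_eqVlt; apply/orP; left; apply/eqP; field; rewrite !gt_eqF.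
  - exact: lt_le_trans (tri_var_ge (ltW pn0) pn2 n4).
  - apply: le_trans v2 _; rewrite -mulrA; apply: ler_wpM2l; first exact: ltW.
    by rewrite -!exprMn lerXn2r ?nnegrE ?mulr_ge0 // ltW.
split; first by exists (1 / 24), s; split; [lra|split].
split.
  exists (4 * A + 32 * B / b); apply: filterS bounds => n /= [t0 tv _ _ _].
  by rewrite powRN.
(* sigma <= S t^(3/2), hence t^(-2) <= S sigma^(-1) t^(-1/2). *)
pose S := Num.sqrt (s * (2 * c) ^+ 3).
exists ((2 * A + 16 * B / b) * S); apply: filterS bounds => n /=.
set t := n%:R `^ (1 - alpha) => -[t0 _ loc v0 v1].
apply: le_trans loc _; rewrite lee_fin -!mulrA; apply: ler_wpM2l.
  apply: addr_ge0; first exact: mulr_ge0.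
  by apply: mulr_ge0 => //; apply: divr_ge0 => //; exact: ltW.
have -> : n%:R `^ (- ((1 - alpha) / 2)) = (Num.sqrt t)^-1.
  by rewrite powRN powRrM powR12_sqrt // ltW.
rewrite -invfM ler_pdivlMr ?mulr_gt0 ?sqrtr_gt0 // mulrC ler_pdivrMr ?exprn_gt0 //.
rewrite -sqrtrM ?(ltW v0) // -[t ^+ 2]ger0_norm ?sqr_ge0 // -sqrtr_sqr -sqrtrM; last first.
  by rewrite mulr_ge0 ?exprn_ge0 ?mulr_ge0 ?(ltW c0) // ltW.
rewrite ler_wsqrtr //.
have -> : s * (2 * c) ^+ 3 * (t ^+ 2) ^+ 2 = s * (2 * c) ^+ 3 * t ^+ 3 * t.
  by ring.
by rewrite ler_wpM2r // ltW.
Unshelve. all: by end_near.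
Qed.
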